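(* Let $n\ge3$, $p>1$, $\lambda\in\mathbb R$ satisfy either (i) $p<\frac{n+2}{n-2}$ and $\lambda<\frac{(n-1)^2}{4}$, or (ii) $n\ge4$, $p=\frac{n+2}{n-2}$ and $\frac{n(n-2)}{4}<\lambda<\frac{(n-1)^2}{4}$. Let $\alpha,\beta\ge0$ be such that $\alpha+\beta\ge2$. Let $\mathcal U_i=\mathcal U[z_i]$, $i=1,2$, be two hyperbolic bubbles such that $d(z_1,z_2)\ge\ln3$. Then: if $\alpha\ne\beta$, there is a constant $C\ge1$ depending only on $|\alpha-\beta|,n,p,\lambda$ such that $$C^{-1}e^{-c(n,\lambda)\min\{\alpha,\beta\}\,d(z_1,z_2)}\le\int_{\mathbb B^n}\mathcal U_1^\alpha\,\mathcal U_2^\beta\,dv\le C\,e^{-c(n,\lambda)\min\{\alpha,\beta\}\,d(z_1,z_2)};$$ if $\alpha=\beta$, there is a constant $C\ge1$ depending only on $n,p,\lambda$ such that $$C^{-1}d(z_1,z_2)\,e^{-c(n,\lambda)\beta\,d(z_1,z_2)}\le\int_{\mathbb B^n}\mathcal U_1^\alpha\,\mathcal U_2^\beta\,dv\le C\,d(z_1,z_2)\,e^{-c(n,\lambda)\beta\,d(z_1,z_2)}.$$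
   Context: $\mathbb B^n$ is the Poincaré ball model of hyperbolic $n$-space: the Euclidean unit ball with metric $\left(\frac{2}{1-|x|^2}\right)^2dx^2$, Laplace-Beltrami operator $\Delta_{\mathbb B^n}$, volume element $dv$ and distance $d(\cdot,\cdot)$. $H^1(\mathbb B^n)$ is the completion of $C_c^\infty(\mathbb B^n)$ with respect to the $L^2$ norm of the hyperbolic gradient. Under the stated conditions on $n,p,\lambda$, $\mathcal U\in H^1(\mathbb B^n)$ denotes the unique positive, radially symmetric (and decreasing) solution of $-\Delta_{\mathbb B^n}\mathcal U-\lambda\,\mathcal U=\mathcal U^p$. Viewing $\mathcal U$ as a function of $d(x,0)$, the hyperbolic bubble centred at $z\in\mathbb B^n$ is $\mathcal U[z](x)=\mathcal U(d(x,z))$. Set $c(n,\lambda)=\frac{n-1+\sqrt{(n-1)^2-4\lambda}}{2}$. The following sharp decay is taken as known: there are constants $\chi_1,\chi_2>0$ depending only on $n,p,\lambda$ with $\chi_1e^{-c(n,\lambda)d(x,z)}\le\mathcal U[z](x)\le\chi_2e^{-c(n,\lambda)d(x,z)}$ for all $x,z\in\mathbb B^n$.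
   Formalization: The constant C is allowed to depend also on an upper bound M for α+β (besides |α−β|, n, p, λ), since a constant uniform over all α+β≥2 with |α−β| fixed does not exist. *)

(* Defs.v *)
From HB Require Import structures.
From mathcomp Require Import all_boot all_order all_algebra.
From mathcomp Require Import all_classical all_reals all_analysis.

Set Implicit Arguments.
Unset Strict Implicit.
Unset Printing Implicit Defensive.

Import Order.TTheory GRing.Theory Num.Theory.
Import numFieldNormedType.Exports.

Local Open Scope classical_set_scope.
Local Open Scope ring_scope.

(* The library has no Lebesgue measure on R^n; it is built on n-tuples as the
   n-fold product of lebesgue_measure, transported along (x, t) |-> x :: t. *)
Section tuple_lebesgue.
Variable R : realType.
Local Notation mR := (measurableTypeR R).

Definition tcons n (xt : mR * n.-tuple mR) : n.+1.-tuple mR :=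
  [the n.+1.-tuple mR of xt.1 :: xt.2].

Lemma measurable_tcons n : measurable_fun setT (@tcons n).
Proof.
apply: measurable_cons; [exact: measurable_fst|exact: measurable_snd].
Qed.

Definition tuncons n (t : n.+1.-tuple mR) : mR * n.-tuple mR :=
  (thead t, [tuple of behead t]).

Lemma measurable_tuncons n : measurable_fun setT (@tuncons n).
Proof.
apply/measurable_fun_pairP; split; last exact: measurable_behead.
exact: measurable_tnth.
Qed.

Lemma tconsK n : cancel (@tcons n) (@tuncons n).
Proof.
by case=> x t; rewrite /tuncons /tcons/= theadE; congr pair; apply/val_inj.
Qed.

Section step.
Variables (n : nat) (mu : {sigma_finite_measure set (n.-tuple mR) -> \bar R}).

Definition leb_step :=
  pushforward (@lebesgue_measure R \x mu)%E (@tcons n).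

Let mpre A : measurable A -> measurable (@tcons n @^-1` A).
Proof. by move=> mA; rewrite -[X in measurable X]setTI; exact: measurable_tcons. Qed.

Let leb_step0 : leb_step set0 = 0%E.
Proof. by rewrite /leb_step /pushforward preimage_set0 measure0. Qed.

Let leb_step_ge0 A : (0 <= leb_step A)%E.
Proof. by rewrite /leb_step /pushforward measure_ge0. Qed.

Let leb_step_sigma_additive : semi_sigma_additive leb_step.
Proof.
move=> F mF tF mUF; rewrite /leb_step /pushforward preimage_bigcup.
apply: measure_semi_sigma_additive.
- by move=> k; exact: mpre.
- apply/trivIsetP => /= i j _ _ ij; rewrite -preimage_setI.
  by move/trivIsetP : tF => /(_ _ _ _ _ ij) ->//; rewrite preimage_set0.
- by rewrite -preimage_bigcup; exact: mpre.
Qed.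

HB.instance Definition _ := isMeasure.Build _ _ _ leb_step
  leb_step0 leb_step_ge0 leb_step_sigma_additive.

Let leb_step_sigma_finite : sigma_finite setT leb_step.
Proof.
have /sigma_finiteP[F [TF ndF Foo]] := sigma_finiteT (@lebesgue_measure R).
have /sigma_finiteP[G [TG ndG Goo]] := sigma_finiteT mu.
exists (fun k => @tuncons n @^-1` (F k `*` G k)).
  rewrite -preimage_bigcup -[LHS](preimage_setT (@tuncons n)); congr preimage.
  rewrite -setXTT TF TG predeqE => -[x y]; split; last first.
    by move=> [k _ []/= ? ?]; split; exists k.
  move=> [/= [k _ Fkx] [l _ Gly]]; exists (maxn k l) => //; split.
  - by move: x Fkx; exact/subsetPset/ndF/leq_maxl.
  - by move: y Gly; exact/subsetPset/ndG/leq_maxr.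
move=> k; have [mF Fk] := Foo k; have [mG Gk] := Goo k; split.
  rewrite -[X in measurable X]setTI; apply: measurable_tuncons => //.
  exact: measurableX.
rewrite /leb_step /pushforward -comp_preimage.
rewrite (_ : _ \o _ = id); last by apply/funext => x /=; rewrite tconsK.
by rewrite preimage_id product_measure1E// lte_mul_pinfty// ge0_fin_numE.
Qed.

HB.instance Definition _ := Measure_isSigmaFinite.Build _ _ _ leb_step
  leb_step_sigma_finite.

End step.

Fixpoint tuple_lebesgue (n : nat) :
    {sigma_finite_measure set (n.-tuple mR) -> \bar R} :=
  match n return {sigma_finite_measure set (n.-tuple mR) -> \bar R} with
  | 0 => [the {sigma_finite_measure set (0.-tuple mR) -> \bar R}
           of dirac [tuple]]
  | m.+1 => [the {sigma_finite_measure set (m.+1.-tuple mR) -> \bar R}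
           of leb_step (tuple_lebesgue m)]
  end.
End tuple_lebesgue.

Section hyperbolic_ball.
Variables (R : realType) (n : nat).
Implicit Types (x y z v : 'rV[R]_n) (f : 'rV[R]_n -> R).

(* The norm `|x| of the library on 'rV[R]_n is the sup norm. *)
Definition sqnorm x : R := \sum_(i < n) x ord0 i ^+ 2.

Definition hball : set 'rV[R]_n := [set x | sqnorm x < 1].

Definition arcosh (t : R) : R := ln (t + Num.sqrt (t ^+ 2 - 1)).

(* Geodesic distance of the metric (2 / (1 - |x|^2))^2 dx^2. *)
Definition hdist x y : R :=
  arcosh (1 + 2 * sqnorm (x - y) / ((1 - sqnorm x) * (1 - sqnorm y))).

(* The metric is (conf x)^2 dx^2. *)
Definition conf x : R := 2 / (1 - sqnorm x).

Definition partial (i : 'I_n) f : 'rV[R]_n -> R :=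
  fun x => 'D_(delta_mx ord0 i) f x.

(* Laplace-Beltrami operator g^(-1/2) d_i (g^(1/2) g^(ij) d_j f) of that metric:
   g^(1/2) = conf^n and g^(ij) = conf^(-2) delta_ij; meant for 2 <= n. *)
Definition hlaplacian f : 'rV[R]_n -> R := fun x =>
  (conf x ^+ n)^-1 *
  \sum_(i < n) partial i (fun y => conf y ^+ (n - 2) * partial i f y) x.

(* |grad_g f|_g^2 = conf^(-2) |df|^2 *)
Definition hgrad_sq f : 'rV[R]_n -> R := fun x =>
  (conf x ^+ 2)^-1 * \sum_(i < n) partial i f x ^+ 2.

Definition point_of (t : n.-tuple (measurableTypeR R)) : 'rV[R]_n :=
  \row_(i < n) tnth t i.

(* Integral over the ball with respect to dv = conf^n dx. *)
Definition hintegral f : \bar R :=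
  (\int[tuple_lebesgue R n]_(t in point_of @^-1` hball)
     (f (point_of t) * conf (point_of t) ^+ n)%:E)%E.

Definition smooth f : Prop := forall (s : seq 'I_n) x,
  differentiable (foldr partial f s) x.

Definition test_function f : Prop :=
  smooth f /\ exists2 r : R, r < 1 & forall x, r <= sqnorm x -> f x = 0.

(* The completion of C_c^oo for |grad f|_(L^2), realized by functions: Cauchy
   sequences for that norm converge in L^2(dv), by the Poincare inequality. *)
Definition in_H1 f : Prop :=
  measurable_fun (point_of @^-1` hball) (f \o point_of) /\
  exists phi : nat -> 'rV[R]_n -> R,
    [/\ forall k, test_function (phi k),
        forall e : R, 0 < e -> exists N : nat, forall k l,
          (N <= k)%N -> (N <= l)%N ->
          (hintegral (hgrad_sq (phi k \- phi l)%R) < e%:E)%E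
      & hintegral (fun x => (phi k x - f x) ^+ 2) @[k --> \oo] --> 0%E].

Definition C2_on_hball f : Prop := forall x, hball x ->
  [/\ differentiable f x,
      forall i, differentiable (partial i f) x
    & forall i j, {for x, continuous (partial j (partial i f))}].

(* u is the radial profile: U x = u (d(x, 0)) and U[z] x = u (d(x, z)). *)
Definition bubble (u : R -> R) z : 'rV[R]_n -> R := fun x => u (hdist x z).

Definition bubble_profile (p lambda : R) (u : R -> R) : Prop :=
  let U := bubble u 0 in
  [/\ in_H1 U, C2_on_hball U,
      forall x, hball x -> 0 < U x,
      forall r s : R, 0 <= r -> r < s -> u s < u r
    & forall x, hball x -> - hlaplacian U x - lambda * U x = U x `^ p].

End hyperbolic_ball.

Definition decay_exponent (R : realType) (n : nat) (lambda : R) : R :=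
  (n%:R - 1 + Num.sqrt ((n%:R - 1) ^+ 2 - 4 * lambda)) / 2.

(* Main.v *)
(* Up to constants each bubble is [expR (- c d)], and [n - 1 < 2 c].  Put
   [D = d(z1, z2)] and let [g k] be the point of the geodesic from [z1] to [z2]
   at distance [k] from [z1].  In the hyperboloid model [cosh d(x, g k)] is a
   combination of [cosh d(x, z1)] and [cosh d(x, z2)], and it follows that
   [a d(x, z1) + b d(x, z2)] is at least [a k + b (D - k) + (a + b) d(x, g k)]
   up to an additive constant, for a suitable integer [k <= D].  As the integral
   of [cosh d(x, z) ^ (- s)] is bounded uniformly in [z] for [n - 1 < s], the
   interaction is at most a multiple of the sum of the [expR (- (a k + b (D - k)))];
   disjoint small balls around the [g k] give the reverse inequality.

   The uniform bound is obtained without invariance of the volume: with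
   [rho = 1 - |x|^2] and [r = 1 - |z|^2], one has
   [16 rho r cosh d(x, z) >= (max (r + rho) (r + |x_j - z_j|)) ^ 2], and
   [n rho] is bounded below by the distance of the largest coordinate [x_i] to
   the ends of the slice of the ball in direction [i], so the integrand is
   dominated by products of one-dimensional kernels. *)

Require Import Defs.
From mathcomp Require Import all_boot all_order all_algebra.
From mathcomp Require Import all_classical all_reals all_analysis.
From mathcomp Require Import measurable_realfun.
From mathcomp Require Import ring lra.

Set Implicit Arguments.
Unset Strict Implicit.
Unset Printing Implicit Defensive.

Import Order.TTheory GRing.Theory Num.Theory.
Import numFieldNormedType.Exports.

Local Open Scope classical_set_scope.
Local Open Scope ring_scope.

(** * Hyperbolic sine and cosine, and [arcosh] as an inverse *)

Section real_hyperbolic_functions.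
Variable R : realType.
Implicit Types r s t : R.

Definition coshR r : R := (expR r + expR (- r)) / 2.
Definition sinhR r : R := (expR r - expR (- r)) / 2.

Lemma coshR_ge0 r : 0 <= coshR r.
Proof. by rewrite divr_ge0// addr_ge0// expR_ge0. Qed.

Lemma sinhR_ge0 r : 0 <= r -> 0 <= sinhR r.
Proof. by move=> r0; rewrite divr_ge0// subr_ge0 ler_expR ge0_cp. Qed.

Lemma sinhR_gt0 r : 0 < r -> 0 < sinhR r.
Proof. by move=> r0; rewrite divr_gt0// subr_gt0 ltr_expR gt0_cp. Qed.

Lemma coshR_sqr r : coshR r ^+ 2 = 1 + sinhR r ^+ 2.
Proof.
have h := expRxMexpNx_1 r; rewrite /coshR /sinhR.
transitivity (expR r * expR (- r) + ((expR r - expR (- r)) / 2) ^+ 2).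
  by field.
by rewrite h.
Qed.

Lemma coshR_ge1 r : 1 <= coshR r.
Proof.
rewrite -(@ler_pXn2r _ 2)// ?nnegrE ?coshR_ge0// coshR_sqr expr1n lerDl.
exact: sqr_ge0.
Qed.

Lemma coshRD r s : coshR (r + s) = coshR r * coshR s + sinhR r * sinhR s.
Proof. by rewrite /coshR /sinhR opprD !expRD; field. Qed.

Lemma expR_coshRD_sinhR r : expR r = coshR r + sinhR r.
Proof. by rewrite /coshR /sinhR; field. Qed.

Lemma arcosh_coshR r : 0 <= r -> arcosh (coshR r) = r.
Proof.
move=> r0; rewrite /arcosh coshR_sqr (addrC 1) addrK.
by rewrite sqrtr_sqr ger0_norm ?sinhR_ge0// -expR_coshRD_sinhR expRK.
Qed.

Lemma arcosh_ge0 t : 1 <= t -> 0 <= arcosh t.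
Proof. by move=> t1; rewrite /arcosh ln_ge0// (le_trans t1)// lerDl sqrtr_ge0. Qed.

Lemma coshR_arcosh t : 1 <= t -> coshR (arcosh t) = t.
Proof.
move=> t1; have t21 : 0 <= t ^+ 2 - 1 by rewrite subr_ge0 exprn_ege1.
set q := Num.sqrt (t ^+ 2 - 1).
have q2 : q ^+ 2 = t ^+ 2 - 1 by rewrite sqr_sqrtr.
have q0 : 0 <= q by exact: sqrtr_ge0.
have tq : 0 < t + q by rewrite ltr_wpDr// (lt_le_trans ltr01).
rewrite /coshR /arcosh -/q expRN lnK ?posrE//.
have -> : (t + q)^-1 = t - q.
  apply: (mulfI (lt0r_neq0 tq)); rewrite divff ?lt0r_neq0//.
  by rewrite mulrC -subr_sqr q2; ring.
by field.
Qed.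

Lemma coshR_le r s : 0 <= r -> 0 <= s -> (coshR r <= coshR s) = (r <= s).
Proof.
move=> r0 s0.
have mono : forall a b : R, 0 <= a -> a < b -> coshR a < coshR b.
  move=> a b a0 ab; rewrite -[b](subrK a) addrC coshRD.
  have ba : 0 < b - a by rewrite subr_gt0.
  have ch : 1 < coshR (b - a).
    rewrite -(@ltr_pXn2r _ 2)// ?nnegrE ?coshR_ge0// coshR_sqr expr1n ltrDl.
    by rewrite exprn_gt0// sinhR_gt0.
  rewrite (@lt_le_trans _ _ (coshR a * coshR (b - a)))//.
    by rewrite ltr_pMr// (lt_le_trans ltr01)// coshR_ge1.
  by rewrite lerDl mulr_ge0 ?sinhR_ge0// ltW.
apply/idP/idP; last first.
  by rewrite le_eqVlt => /orP[/eqP->//|/(mono _ _ r0)/ltW].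
by apply: contraTT; rewrite -!ltNge => /(mono _ _ s0).
Qed.

Lemma coshR_le_expR r : 0 <= r -> coshR r <= expR r.
Proof. by move=> r0; rewrite expR_coshRD_sinhR lerDl sinhR_ge0. Qed.

End real_hyperbolic_functions.

(** The common source of two Cauchy-Schwarz inequalities, one for [dot] and one for the Lorentz form
    on the orthogonal complement of a point of the hyperboloid. *)
Lemma quadratic_form_discriminant (R : realFieldType) (p q s : R) :
  (forall a b, 0 <= p * a ^+ 2 + 2 * q * a * b + s * b ^+ 2) ->
  q ^+ 2 <= p * s.
Proof.
move=> h.
have p0 : 0 <= p by have := h 1 0; rewrite !(mulr0, addr0, expr1n, expr0n, mulr1).
have s0 : 0 <= s by have := h 0 1; rewrite !(mulr0, addr0, add0r, mul0r, expr1n, expr0n, mulr1).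
(* At [(q, - p)] and [(s, - q)] the form equals [p] and [s] times [p * s - q ^+ 2]. The values at
   [(1, 1)] and [(1, -1)] give [q = 0] when [p] and [s] both vanish. *)
have h1 := h q (- p); have h2 := h s (- q); have h3 := h 1 1; have h4 := h 1 (-1).
have h5 : 0 <= p * (p * s - q ^+ 2) by move: h1; lra.
have h6 : 0 <= s * (p * s - q ^+ 2) by move: h2; lra.
have [p0'|p_gt0] := leP p 0; last by rewrite -subr_ge0 -(pmulr_rge0 _ p_gt0).
have [s0'|s_gt0] := leP s 0; last by rewrite -subr_ge0 -(pmulr_rge0 _ s_gt0).
have -> : q = 0 by lra.
by rewrite expr0n mulr_ge0.
Qed.

(** * Geometry of the ball: hyperboloid model, triangle inequality, geodesics *)

Section ball_geometry.
Variables (R : realType) (n : nat).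
Implicit Types (x y z v w : 'rV[R]_n).

Definition dot x y : R := \sum_(i < n) x ord0 i * y ord0 i.

Lemma dotC x y : dot x y = dot y x.
Proof. by apply: eq_bigr => i _; rewrite mulrC. Qed.

Lemma dotDl x y z : dot (x + y) z = dot x z + dot y z.
Proof. by rewrite -big_split/=; apply: eq_bigr => i _; rewrite mxE mulrDl. Qed.

Lemma dotZl a x y : dot (a *: x) y = a * dot x y.
Proof. by rewrite mulr_sumr; apply: eq_bigr => i _; rewrite mxE mulrA. Qed.

Lemma dotNl x y : dot (- x) y = - dot x y.
Proof. by rewrite -scaleN1r dotZl mulN1r. Qed.

Lemma dotDr x y z : dot x (y + z) = dot x y + dot x z.
Proof. by rewrite dotC dotDl !(dotC x). Qed.

Lemma dotZr a x y : dot x (a *: y) = a * dot x y.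
Proof. by rewrite dotC dotZl dotC. Qed.

Lemma dotNr x y : dot x (- y) = - dot x y.
Proof. by rewrite dotC dotNl dotC. Qed.

Definition dotE := (dotDl, dotDr, dotZl, dotZr, dotNl, dotNr).

Lemma sqnorm_dot x : sqnorm x = dot x x.
Proof. by apply: eq_bigr => i _; rewrite expr2. Qed.

Lemma sqnorm_ge0 x : 0 <= sqnorm x.
Proof. by apply: sumr_ge0 => i _; exact: sqr_ge0. Qed.

Lemma sqnormB x y : sqnorm (x - y) = sqnorm x - 2 * dot x y + sqnorm y.
Proof. by rewrite !sqnorm_dot !dotE (dotC y x); ring. Qed.

Lemma sqnormBC x y : sqnorm (x - y) = sqnorm (y - x).
Proof. by rewrite !sqnormB dotC; ring. Qed.

Lemma dot_sqr_le x y : dot x y ^+ 2 <= sqnorm x * sqnorm y.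
Proof.
apply: quadratic_form_discriminant => a b.
have := sqnorm_ge0 (a *: x + b *: y); rewrite !sqnorm_dot !dotE (dotC y x).
by congr (0 <= _); ring.
Qed.

Definition cosh_hdist x y : R :=
  1 + 2 * sqnorm (x - y) / ((1 - sqnorm x) * (1 - sqnorm y)).

Lemma rho_gt0 x : hball x -> 0 < 1 - sqnorm x.
Proof. by rewrite subr_gt0. Qed.

Lemma cosh_hdist_ge1 x y : hball x -> hball y -> 1 <= cosh_hdist x y.
Proof.
move=> /rho_gt0 hx /rho_gt0 hy; rewrite lerDl divr_ge0 ?mulr_ge0 ?sqnorm_ge0//.
  exact: ltW.
exact: ltW.
Qed.

Lemma cosh_hdistC x y : cosh_hdist x y = cosh_hdist y x.
Proof. by rewrite /cosh_hdist sqnormBC (mulrC (1 - sqnorm x)). Qed.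

Lemma hdistC x y : hdist x y = hdist y x.
Proof. by rewrite /hdist -!/(cosh_hdist _ _) cosh_hdistC. Qed.

Lemma hdist_ge0 x y : hball x -> hball y -> 0 <= hdist x y.
Proof. by move=> hx hy; exact/arcosh_ge0/cosh_hdist_ge1. Qed.

Lemma coshR_hdist x y : hball x -> hball y -> coshR (hdist x y) = cosh_hdist x y.
Proof. by move=> hx hy; exact/coshR_arcosh/cosh_hdist_ge1. Qed.

(* The hyperboloid model: [x] corresponds to the unit timelike vector
   [(htime x, hspace x)], and [cosh d] is minus the Lorentz product.
   The lock prevents [dotZl] from unfolding [hspace]. *)
Definition htime x : R := (1 + sqnorm x) / (1 - sqnorm x).
Definition hspace x := locked ((2 / (1 - sqnorm x)) *: x).

Lemma cosh_hdistE x y : hball x -> hball y ->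
  cosh_hdist x y = htime x * htime y - dot (hspace x) (hspace y).
Proof.
move=> /rho_gt0/lt0r_neq0 hx /rho_gt0/lt0r_neq0 hy.
rewrite /cosh_hdist /htime /hspace -!lock !dotE sqnormB; field.
by rewrite hx hy.
Qed.

Lemma sqnorm_hspace x : hball x -> sqnorm (hspace x) = htime x ^+ 2 - 1.
Proof.
move=> /rho_gt0/lt0r_neq0 hx; rewrite sqnorm_dot /hspace -!lock !dotE -sqnorm_dot /htime.
by field.
Qed.

Lemma htime_ge1 x : hball x -> 1 <= htime x.
Proof.
move=> hx; have := sqnorm_ge0 x; have := rho_gt0 hx => r0 s0.
by rewrite /htime ler_pdivlMr// mul1r; lra.
Qed.

(** Projecting the upper sheet from [(-1, 0)] onto the hyperplane of time [0] sends [(t, v)] to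
    [(1 + t)^-1 *: v], which inverts the parametrization. *)
Lemma hyperboloid_point (t : R) v : 1 <= t -> sqnorm v = t ^+ 2 - 1 ->
  exists2 g : 'rV[R]_n, hball g & htime g = t /\ hspace g = v.
Proof.
move=> t1 vt; have t10 : 1 + t != 0 by rewrite lt0r_neq0//; lra.
have t0 : t != 0 by rewrite lt0r_neq0//; lra.
pose g : 'rV[R]_n := (1 + t)^-1 *: v.
have gE : sqnorm g = (t - 1) / (1 + t).
  by rewrite sqnorm_dot !dotE -sqnorm_dot vt; field.
have rE : 1 - sqnorm g = 2 / (1 + t) by rewrite gE; field.
exists g.
  rewrite /hball/= -subr_gt0 rE divr_gt0//; lra.
split; first by rewrite /htime rE gE; field; rewrite t10.
by rewrite /hspace -lock rE scalerA (_ : _ * _ = 1) ?scale1r//; field.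
Qed.

(** The condition on the weights says that the combination of the two hyperboloid vectors has
    Lorentz square [-1]; nonnegative weights keep it on the upper sheet. The formula for
    [cosh_hdist x g] is then linearity of the Lorentz product. *)
Lemma hyperbolic_combination z1 z2 (w1 w2 : R) :
  hball z1 -> hball z2 -> 0 <= w1 -> 0 <= w2 ->
  w1 ^+ 2 + w2 ^+ 2 + 2 * w1 * w2 * cosh_hdist z1 z2 = 1 ->
  exists2 g : 'rV[R]_n, hball g & forall x, hball x ->
    cosh_hdist x g = w1 * cosh_hdist x z1 + w2 * cosh_hdist x z2.
Proof.
move=> h1 h2 w10 w20; rewrite cosh_hdistE// => w12.
pose t := w1 * htime z1 + w2 * htime z2.
pose v : 'rV[R]_n := w1 *: hspace z1 + w2 *: hspace z2.
have t_ge0 : 0 <= t.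
  by rewrite addr_ge0// mulr_ge0// (le_trans ler01)// htime_ge1.
have vt : sqnorm v = t ^+ 2 - 1.
  rewrite -[X in _ - X]w12 sqnorm_dot /v !dotE -!sqnorm_dot !sqnorm_hspace//.
  by rewrite (dotC (hspace z2)) /t; ring.
have t1 : 1 <= t.
  by rewrite -(@ler_pXn2r _ 2)// ?nnegrE// expr1n -subr_ge0 -vt sqnorm_ge0.
have [g hg [gt gv]] := hyperboloid_point t1 vt.
exists g => // x hx; rewrite !cosh_hdistE// gt gv /t /v !dotE; ring.
Qed.

(* A vector Lorentz-orthogonal to a timelike vector is spacelike, so that
   Cauchy-Schwarz holds on the orthogonal complement of the point [y]. *)
Lemma cosh_hdist_gram x y z : hball x -> hball y -> hball z ->
  (cosh_hdist x y * cosh_hdist y z - cosh_hdist x z) ^+ 2 <=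
  (cosh_hdist x y ^+ 2 - 1) * (cosh_hdist y z ^+ 2 - 1).
Proof.
move=> hx hy hz; set A := cosh_hdist x y; set B := cosh_hdist y z.
apply: quadratic_form_discriminant => a b.
(* [(t, v)] combines the Lorentz projections of [x] and [z] onto the complement of [y]; its Lorentz
   square is the quadratic form in [a] and [b]. *)
pose t := a * (htime x - A * htime y) + b * (htime z - B * htime y).
pose v := a *: (hspace x - A *: hspace y) + b *: (hspace z - B *: hspace y).
have AE : A = htime x * htime y - dot (hspace x) (hspace y) by rewrite -cosh_hdistE.
have BE : B = htime y * htime z - dot (hspace y) (hspace z) by rewrite -cosh_hdistE.
have ort : t * htime y = dot v (hspace y).
  rewrite /t /v !dotE -sqnorm_dot sqnorm_hspace// (dotC (hspace z)).
  by rewrite AE BE; ring.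
have ty : 0 < htime y by rewrite (lt_le_trans ltr01)// htime_ge1.
have tv : t ^+ 2 <= sqnorm v.
  rewrite -(@ler_pM2r _ (htime y ^+ 2)) ?exprn_gt0// -exprMn ort.
  apply: (le_trans (dot_sqr_le _ _)); rewrite sqnorm_hspace//.
  by rewrite ler_wpM2l ?sqnorm_ge0// gerBl.
move: tv; rewrite -subr_ge0; congr (0 <= _).
rewrite /v /t sqnorm_dot !dotE -!sqnorm_dot !sqnorm_hspace//.
rewrite (dotC (hspace z) (hspace y)) (dotC (hspace y) (hspace x)).
rewrite (dotC (hspace z) (hspace x)).
have -> : dot (hspace x) (hspace y) = htime x * htime y - A by rewrite AE; ring.
have -> : dot (hspace y) (hspace z) = htime y * htime z - B by rewrite BE; ring.
by rewrite (cosh_hdistE hx hz); ring.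
Qed.

(** The Gram inequality bounds [cosh_hdist x z - cosh_hdist x y * cosh_hdist y z] by the product of
    the two hyperbolic sines, and the addition formula for [coshR] concludes. *)
Lemma hdist_triangle x y z : hball x -> hball y -> hball z ->
  hdist x z <= hdist x y + hdist y z.
Proof.
move=> hx hy hz; have dxy := hdist_ge0 hx hy; have dyz := hdist_ge0 hy hz.
rewrite -coshR_le ?addr_ge0 ?hdist_ge0// coshRD !coshR_hdist//.
have := cosh_hdist_gram hx hy hz; rewrite -!coshR_hdist// !coshR_sqr.
rewrite ![1 + _]addrC !addrK -exprMn => h.
rewrite -lerBlDl (le_trans (ler_norm _))// -(ler_pXn2r (n := 2))// ?nnegrE//.
  by rewrite real_normK ?num_real// -sqrrN opprB.
by rewrite mulr_ge0// sinhR_ge0.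
Qed.

Lemma hdist_triangle_sub x y z : hball x -> hball y -> hball z ->
  `|hdist x y - hdist x z| <= hdist y z.
Proof.
move=> hx hy hz; rewrite ler_norml; apply/andP; split.
  by have := hdist_triangle hx hy hz; lra.
by have := hdist_triangle hx hz hy; rewrite (hdistC z y); lra.
Qed.

(* Stewart's theorem of hyperbolic geometry. *)
Lemma geodesic_point z1 z2 (s : R) : hball z1 -> hball z2 ->
  0 < hdist z1 z2 -> 0 <= s <= hdist z1 z2 ->
  let D := hdist z1 z2 in
  exists g : 'rV[R]_n, [/\ hball g, hdist z1 g = s, hdist z2 g = D - s &
    forall x, hball x -> cosh_hdist x g * sinhR D =
      sinhR (D - s) * cosh_hdist x z1 + sinhR s * cosh_hdist x z2].
Proof.
move=> h1 h2 D0 /andP[s0 sD] D.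
have S0 : sinhR D != 0 by rewrite lt0r_neq0// sinhR_gt0.
have Ds : 0 <= D - s by rewrite subr_ge0.
have S0' := sinhR_gt0 D0.
have sdiv : forall r : R, 0 <= r -> 0 <= sinhR r / sinhR D.
  by move=> r r0; apply: divr_ge0; [exact: sinhR_ge0|exact: ltW].
have sinhD : sinhR D = sinhR (D - s) * coshR s + coshR (D - s) * sinhR s.
  by rewrite -{1}[D](subrK s) /sinhR /coshR opprD !expRD; field.
have coshD : coshR D = coshR (D - s) * coshR s + sinhR (D - s) * sinhR s.
  by rewrite -coshRD subrK.
(* These are the weights of the hyperboloid geodesic; the normalization required by
   [hyperbolic_combination] follows by expanding [D = (D - s) + s]. *)
have [|g hg gE] := hyperbolic_combination h1 h2 (sdiv _ Ds) (sdiv _ s0).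
  rewrite -coshR_hdist// -/D.
  have -> : (sinhR (D - s) / sinhR D) ^+ 2 + (sinhR s / sinhR D) ^+ 2 +
    2 * (sinhR (D - s) / sinhR D) * (sinhR s / sinhR D) * coshR D =
    (sinhR (D - s) ^+ 2 + sinhR s ^+ 2 + 2 * sinhR (D - s) * sinhR s * coshR D)
      / sinhR D ^+ 2 by field.
  suff -> : sinhR (D - s) ^+ 2 + sinhR s ^+ 2 +
      2 * sinhR (D - s) * sinhR s * coshR D = sinhR D ^+ 2.
    by rewrite divff// expf_neq0.
  rewrite sinhD coshD.
  have := coshR_sqr s; have := coshR_sqr (D - s).
  set a := sinhR _; set b := coshR _; set c := sinhR _; set d := coshR _.
  move=> b2 d2; have -> : a ^+ 2 + c ^+ 2 + 2 * a * c * (b * d + a * c) =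
    a ^+ 2 * (1 + c ^+ 2) + c ^+ 2 * (1 + a ^+ 2) + 2 * a * c * b * d by ring.
  rewrite -d2 -b2; ring.
have gE' : forall x, hball x -> cosh_hdist x g * sinhR D =
      sinhR (D - s) * cosh_hdist x z1 + sinhR s * cosh_hdist x z2.
  by move=> x hx; rewrite gE//; field.
have cosh_self : forall z, hball z -> cosh_hdist z z = 1.
  by move=> z _; rewrite /cosh_hdist sqnormB sqnorm_dot (_ : _ - _ + _ = 0) ?mulr0 ?mul0r ?addr0//; ring.
(* Setting [x := z1] and [x := z2] in [gE'] determines [cosh_hdist] from each endpoint to [g], hence
   the two distances. *)
exists g; split => //.
- rewrite /hdist -/(cosh_hdist z1 g) (_ : cosh_hdist z1 g = coshR s) ?arcosh_coshR//.
  apply: (mulIf S0); rewrite gE'// cosh_self// -coshR_hdist// -/D sinhD coshD.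
  have := coshR_sqr s.
  set a := sinhR _; set b := coshR _; set c := sinhR _; set d := coshR _ => d2.
  have -> : c * 1 + a * (d * b + c * a) = c * (1 + a ^+ 2) + a * d * b by ring.
  by rewrite -d2; ring.
- rewrite /hdist -/(cosh_hdist z2 g) (_ : cosh_hdist z2 g = coshR (D - s)) ?arcosh_coshR//.
  apply: (mulIf S0); rewrite gE'// cosh_self// cosh_hdistC -coshR_hdist// -/D sinhD coshD.
  have := coshR_sqr (D - s).
  set a := sinhR _; set b := coshR _; set c := sinhR _; set d := coshR _ => d2.
  have -> : a * (b * d + a * c) + c * 1 = c * (1 + a ^+ 2) + a * b * d by ring.
  by rewrite -d2; ring.
Qed.

End ball_geometry.

(** * Comparison of integrals of nonnegative functions *)

Section monotone_integral.
Local Open Scope ereal_scope.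
Context d (T : measurableType d) (R : realType).
Variable mu : {measure set T -> \bar R}.
Variables (D : set T) (f1 f2 : T -> \bar R).

(* Unlike [ge0_le_integral], no measurability is needed here. *)
Lemma ge0_le_integral_all : (forall x, D x -> 0 <= f1 x) ->
  (forall x, D x -> f1 x <= f2 x) ->
  \int[mu]_(x in D) f1 x <= \int[mu]_(x in D) f2 x.
Proof.
move=> f10 f12.
have f20 x : D x -> 0 <= f2 x by move=> Dx; exact: le_trans (f10 _ Dx) (f12 _ Dx).
have h10 x : 0 <= (f1 \_ D) x by exact: erestrict_ge0.
have h20 x : 0 <= (f2 \_ D) x by exact: erestrict_ge0.
(* Both integrals are suprema over the simple functions below the integrand, and every simple
   function below [f1] is below [f2]. *)
rewrite (integral_mkcond D f1) (integral_mkcond D f2) !ge0_integralTE//.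
apply: ub_ereal_sup => _ [h hf <-]; apply: ereal_sup_ubound; exists h => //= x.
by rewrite (le_trans (hf x))//= !patchE; case: ifPn => // /set_mem /f12.
Qed.

End monotone_integral.

(** * Tonelli's theorem and product integrands on tuples *)

Section tuple_integral.
Variable R : realType.
Local Notation mR := (measurableTypeR R).
Local Notation leb := (@lebesgue_measure R).

Lemma tuple_tonelli1 n (f : n.+1.-tuple mR -> \bar R) :
  measurable_fun setT f -> (forall t, 0 <= f t)%E ->
  (\int[tuple_lebesgue R n.+1]_t f t =
   \int[leb]_x \int[tuple_lebesgue R n]_t f (tcons (x, t)))%E.
Proof.
move=> mf f0.
transitivity (\int[leb \x tuple_lebesgue R n]_xt f (tcons xt))%E.
  rewrite /= /leb_step (@ge0_integral_pushforward _ _ _ _ _ _ (@measurable_tcons R n))//.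
by rewrite fubini_tonelli1//; exact: measurableT_comp mf (@measurable_tcons R n).
Qed.

Lemma tuple_tonelli2 n (f : n.+1.-tuple mR -> \bar R) :
  measurable_fun setT f -> (forall t, 0 <= f t)%E ->
  (\int[tuple_lebesgue R n.+1]_t f t =
   \int[tuple_lebesgue R n]_t \int[leb]_x f (tcons (x, t)))%E.
Proof.
move=> mf f0.
transitivity (\int[leb \x tuple_lebesgue R n]_xt f (tcons xt))%E.
  rewrite /= /leb_step (@ge0_integral_pushforward _ _ _ _ _ _ (@measurable_tcons R n))//.
by rewrite fubini_tonelli2//; exact: measurableT_comp mf (@measurable_tcons R n).
Qed.

Lemma tnth_tcons0 n (x : mR) (t : n.-tuple mR) : tnth (tcons (x, t)) ord0 = x.
Proof. by []. Qed.

Lemma tnth_tconsS n (x : mR) (t : n.-tuple mR) j :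
  tnth (tcons (x, t)) (lift ord0 j) = tnth t j.
Proof. by rewrite /tcons /= tnthS. Qed.


Lemma measurable_prod_tnth n (P : pred 'I_n) (K : 'I_n -> R -> R) :
  (forall j, measurable_fun setT (K j)) ->
  measurable_fun setT (fun t : n.-tuple mR => \prod_(j < n | P j) K j (tnth t j)).
Proof.
move=> mK; under eq_fun do rewrite big_mkcond.
apply: measurable_prod => j _; case: (P j) => //.
exact: measurableT_comp (mK j) (measurable_tnth j).
Qed.

Lemma integral_prod_tnth n (K : 'I_n -> R -> R) (B : 'I_n -> R) :
  (forall j, measurable_fun setT (K j)) -> (forall j x, 0 <= K j x) ->
  (forall j, \int[leb]_x (K j x)%:E = (B j)%:E)%E ->
  (\int[tuple_lebesgue R n]_t (\prod_(j < n) K j (tnth t j))%:E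
   = (\prod_(j < n) B j)%:E)%E.
Proof.
elim: n => [|n IH] in K B * => mK K0 KB.
  under eq_integral do rewrite big_ord0.
  by rewrite integral_cst//= diracT mul1e big_ord0.
rewrite tuple_tonelli2; last 2 first.
- by apply/measurable_EFinP; exact: measurable_prod_tnth.
- by move=> t; rewrite lee_fin prodr_ge0.
pose P (t : n.-tuple mR) := \prod_(j < n) K (lift ord0 j) (tnth t j).
have P0 t : 0 <= P t by rewrite prodr_ge0.
have mP : measurable_fun setT P.
  exact: (@measurable_prod_tnth _ _ (fun j => K (lift ord0 j))).
have B0 : 0 <= B ord0.
  by rewrite -lee_fin -KB integral_ge0// => x _; rewrite lee_fin.
transitivity (\int[tuple_lebesgue R n]_t ((B ord0)%:E * (P t)%:E))%E.
  apply: eq_integral => t _.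
  under eq_integral => x _.
    rewrite big_ord_recl tnth_tcons0.
    under eq_bigr do rewrite tnth_tconsS.
    rewrite -/(P t) mulrC EFinM; over.
  rewrite ge0_integralZl_EFin//; last 2 first.
  - by move=> x _; rewrite lee_fin.
  - by apply/measurable_EFinP; exact: mK.
  by rewrite muleC KB.
rewrite ge0_integralZl_EFin//; last 2 first.
- by move=> t _; rewrite lee_fin.
- by apply/measurable_EFinP; exact: mP.
rewrite big_ord_recl EFinM; congr (_ * _)%E.
exact: (IH (fun j => K (lift ord0 j)) (fun j => B (lift ord0 j))).
Qed.

Lemma integral_prod_tnth_le n (K : 'I_n -> R -> R) (B : R) :
  (forall j, measurable_fun setT (K j)) -> (forall j x, 0 <= K j x) ->
  (forall j, \int[leb]_x (K j x)%:E <= B%:E)%E ->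
  (\int[tuple_lebesgue R n]_t (\prod_(j < n) K j (tnth t j))%:E
   <= (B ^+ n)%:E)%E.
Proof.
move=> mK K0 KB.
have I0 j : (0 <= \int[leb]_x (K j x)%:E)%E.
  by rewrite integral_ge0// => x _; rewrite lee_fin.
pose b j := fine (\int[leb]_x (K j x)%:E).
have bE j : (\int[leb]_x (K j x)%:E = (b j)%:E)%E.
  by rewrite fineK// ge0_fin_numE// (le_lt_trans (KB j))// ltry.
rewrite (integral_prod_tnth mK K0 bE) lee_fin -[n in _ ^+ n]card_ord -prodr_const.
by apply: ler_prod => j _; rewrite -!lee_fin -bE I0 KB.
Qed.

Definition tset n (t : n.-tuple mR) (i : 'I_n) (s : mR) : n.-tuple mR :=
  [tuple if j == i then s else tnth t j | j < n].

Lemma tset_tcons0 n (t : n.-tuple mR) x s : tset (tcons (x, t)) ord0 s = tcons (s, t).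
Proof.
apply: eq_from_tnth => j; rewrite tnth_mktuple.
case: (unliftP ord0 j) => [j' ->|->]; last by rewrite eqxx.
by rewrite eq_sym (negbTE (neq_lift _ _)) !tnth_tconsS.
Qed.

Lemma tset_tconsS n (t : n.-tuple mR) x i s :
  tset (tcons (x, t)) (lift ord0 i) s = tcons (x, tset t i s).
Proof.
apply: eq_from_tnth => j; rewrite tnth_mktuple.
case: (unliftP ord0 j) => [j' ->|->].
  by rewrite (inj_eq lift_inj) !tnth_tconsS tnth_mktuple.
by rewrite (negbTE (neq_lift _ _)).
Qed.

(** Coordinate [i] is integrated first, with the others frozen: [phi] may depend on all coordinates,
    but its integral along [i] is at most [A] on every line. The induction splits off the head
    coordinate, as the outermost integral when it differs from [i] and as the innermost one when it
    is [i]. *)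
Lemma integral_slice_le n (i : 'I_n) (phi : n.-tuple mR -> R)
    (K : 'I_n -> R -> R) (A B : R) :
  measurable_fun setT phi -> (forall t, 0 <= phi t) ->
  (forall j, measurable_fun setT (K j)) -> (forall j x, 0 <= K j x) ->
  0 <= A -> 0 <= B -> (forall j, \int[leb]_x (K j x)%:E <= B%:E)%E ->
  (forall t, \int[leb]_s (phi (tset t i s))%:E <= A%:E)%E ->
  (\int[tuple_lebesgue R n]_t
     (phi t * \prod_(j < n | j != i) K j (tnth t j))%:E
   <= (A * B ^+ n.-1)%:E)%E.
Proof.
elim: n => [|n IH] in i phi K *; first by case: i.
move=> mphi phi0 mK K0 A0 B0 KB phiA.
have mf : measurable_fun setT (fun t : n.+1.-tuple mR =>
    (phi t * \prod_(j < n.+1 | j != i) K j (tnth t j))%:E).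
  apply/measurable_EFinP; apply: measurable_funM => //.
  exact: measurable_prod_tnth.
have f0 t : (0 <= (phi t * \prod_(j < n.+1 | j != i) K j (tnth t j))%:E)%E.
  by rewrite lee_fin mulr_ge0// prodr_ge0.
have mphix x : measurable_fun setT (fun t : n.-tuple mR => phi (tcons (x, t))).
  by apply: measurableT_comp => //; apply: measurableT_comp (@measurable_tcons R n) _.
have mphit t : measurable_fun setT (fun x : mR => phi (tcons (x, t))).
  by apply: measurableT_comp => //; apply: measurableT_comp (@measurable_tcons R n) _.
case: (unliftP ord0 i) => [i' ei|ei]; subst i.
- rewrite tuple_tonelli1//=.
  apply: (@le_trans _ _ (\int[leb]_x ((A * B ^+ n.-1)%:E * (K ord0 x)%:E))%E).
    apply: ge0_le_integral_all => x _; first by rewrite integral_ge0.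
    under eq_integral => t _.
      rewrite big_mkcond big_ord_recl/= tnth_tcons0 mulrCA EFinM -big_mkcond/=.
      rewrite (eq_bigl (fun j => j != i')); last first.
        by move=> j; rewrite (inj_eq lift_inj).
      under eq_bigr do rewrite tnth_tconsS.
      over.
    rewrite ge0_integralZl_EFin//; last 2 first.
    - by move=> t _; rewrite lee_fin mulr_ge0// prodr_ge0.
    - apply/measurable_EFinP; apply: measurable_funM => //.
      exact: (@measurable_prod_tnth _ _ (fun j => K (lift ord0 j))).
    rewrite muleC lee_wpmul2r ?lee_fin//.
    apply: (IH i' (fun t => phi (tcons (x, t))) (fun j => K (lift ord0 j))) => //.
    by move=> t; under eq_integral do rewrite -tset_tconsS; exact: phiA.
  rewrite ge0_integralZl_EFin//; last 3 first.
  - by move=> x _; rewrite lee_fin.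
  - by apply/measurable_EFinP; exact: mK.
  - by rewrite mulr_ge0// exprn_ge0.
  rewrite (@le_trans _ _ ((A * B ^+ n.-1)%:E * B%:E)%E)//.
    by rewrite lee_wpmul2l// lee_fin mulr_ge0// exprn_ge0.
  (* [n.-1.+1 = n] because [i' : 'I_n] excludes [n = 0]. *)
  rewrite -EFinM lee_fin -mulrA -exprSr prednK//.
  by case: (n) (i') => // -[].
- rewrite tuple_tonelli2//=.
  pose P (t : n.-tuple mR) := \prod_(j < n) K (lift ord0 j) (tnth t j).
  have P0 t : 0 <= P t by rewrite prodr_ge0.
  have mP : measurable_fun setT P by exact: (@measurable_prod_tnth _ _ (fun j => K (lift ord0 j))).
  apply: (@le_trans _ _ (\int[tuple_lebesgue R n]_t (A%:E * (P t)%:E))%E).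
    apply: ge0_le_integral_all => t _; first by rewrite integral_ge0.
    under eq_integral => x _.
      rewrite big_mkcond big_ord_recl/= mul1r.
      under eq_bigr do rewrite tnth_tconsS.
      rewrite -/(P t) mulrC EFinM; over.
    rewrite ge0_integralZl_EFin//; last 2 first.
    - by move=> x _; rewrite lee_fin.
    - by apply/measurable_EFinP; exact: mphit.
    rewrite muleC lee_wpmul2r ?lee_fin//.
    (* The head [0] is arbitrary, since [tset] overwrites it. *)
    rewrite (le_trans _ (phiA (tcons (0, t))))//.
    by under [leRHS]eq_integral do rewrite tset_tcons0.
  rewrite ge0_integralZl_EFin//; last 2 first.
  - by move=> t _; rewrite lee_fin.
  - by apply/measurable_EFinP; exact: mP.
  rewrite EFinM lee_wpmul2l ?lee_fin//.
  by apply: (@integral_prod_tnth_le n (fun j => K (lift ord0 j))).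
Qed.

End tuple_integral.

(** * One-dimensional kernels *)

Section kernel_integral.
Variable R : realType.
Local Notation mR := (measurableTypeR R).
Local Notation leb := (@lebesgue_measure R).
Implicit Types (r s t x q : R).

Lemma powRN_le x y s : 0 < x -> x <= y -> 0 <= s -> y `^ (- s) <= x `^ (- s).
Proof.
move=> x0 xy s0; have y0 : 0 < y := lt_le_trans x0 xy.
by rewrite !powRN lef_pV2 ?posrE ?powR_gt0// ge0_ler_powR// nnegrE ltW.
Qed.

Lemma powR_exprn q k s : 0 <= q -> (q ^+ k) `^ s = (q `^ s) ^+ k.
Proof.
move=> q0; elim: k => [|k IH]; first by rewrite !expr0 powR1.
by rewrite !exprS powRM ?exprn_ge0// IH.
Qed.

Lemma powRS x s : 0 < x -> x * x `^ s = x `^ (1 + s).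
Proof.
by move=> x0; rewrite powRD ?powRr1 ?ltW// implybE (gt_eqF x0) orbT.
Qed.

Lemma powRD_gt0 x s t : 0 < x -> x `^ (s + t) = x `^ s * x `^ t.
Proof. by move=> x0; rewrite powRD// implybE (gt_eqF x0) orbT. Qed.

Lemma geometric_sum_le q n : 0 <= q < 1 -> \sum_(k < n) q ^+ k <= (1 - q)^-1.
Proof.
move=> /andP[q0 q1]; have q1' : 0 < 1 - q by rewrite subr_gt0.
rewrite -(ler_pM2l q1') divff ?gt_eqF//.
have := subrX1 q n => /(congr1 -%R); rewrite -mulNr opprB opprB => <-.
by rewrite gerBl exprn_ge0.
Qed.

Lemma integral_interval_cst (c h tau : R) : 0 <= c -> 0 <= h ->
  (\int[leb]_t (c * \1_(`[tau - h, tau + h]) t)%:E = (c * (2 * h))%:E)%E.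
Proof.
move=> c0 h0; under eq_integral do rewrite EFinM.
rewrite ge0_integralZl_EFin//; last first.
  by apply/measurable_EFinP; exact: measurable_indic.
rewrite integral_indic//= setIT lebesgue_measure_itv/= lte_fin.
have [_|] := ltP (tau - h) (tau + h).
  by rewrite -EFinB -EFinM; congr (_ * _)%:E; ring.
move=> hh; have -> : h = 0 by lra.
by rewrite !mulr0 mule0.
Qed.

(** A singularity at [0], integrable when [th < 1], and decay of order [th + e] beyond the scale
    [r]. *)
Definition riesz_kernel (th e r t : R) : R :=
  `|t| `^ (- th) * (r + `|t|) `^ (- e).

Lemma riesz_kernel_ge0 th e r t : 0 <= riesz_kernel th e r t.
Proof. by rewrite mulr_ge0// powR_ge0. Qed.

Lemma measurable_riesz_kernel th e r : measurable_fun setT (riesz_kernel th e r).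
Proof.
apply: measurable_funM.
  exact: measurableT_comp (measurable_powR _) (@normr_measurable R setT).
apply: measurableT_comp (measurable_powR _) _.
apply: measurable_funD => //; exact: normr_measurable.
Qed.

(** A nonzero [t] lies in a dyadic shell relative to [r]. If |t| <= r, then r 2^-(k+1) < |t| <= r
    2^-k, and r + |t| is bounded below by [r]; otherwise r 2^k <= |t| <= r 2^(k+1), and both factors
    are estimated at r 2^k. Each case uses one summand. *)
Lemma riesz_kernel_dyadic th e r t : 0 <= th -> 0 <= e -> 0 < r ->
  exists k, riesz_kernel th e r t <=
    (r * 2^-1 ^+ k.+1) `^ (- th) * r `^ (- e) *
      \1_(`[- (r * 2^-1 ^+ k), r * 2^-1 ^+ k]) t +
    (r * 2 ^+ k) `^ (- th - e) * \1_(`[- (r * 2 ^+ k.+1), r * 2 ^+ k.+1]) t.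
Proof.
move=> th0 e0 r0.
have indE (h : R) : \1_(`[- h, h]) t = (`|t| <= h)%R%:R :> R.
  rewrite indicE; congr (nat_of_bool _)%:R.
  by apply/idP/idP; rewrite ler_norml inE/= in_itv/=.
setoid_rewrite indE.
have q0 k : 0 < r * 2^-1 ^+ k by rewrite mulr_gt0// exprn_gt0// invr_gt0.
have p0 k : 0 < r * 2 ^+ k by rewrite mulr_gt0// exprn_gt0.
have T10 k : 0 <= (r * 2^-1 ^+ k.+1) `^ (- th) * r `^ (- e) * (`|t| <= r * 2^-1 ^+ k)%R%:R.
  by rewrite !mulr_ge0 ?powR_ge0.
have T20 k : 0 <= (r * 2 ^+ k) `^ (- th - e) * (`|t| <= r * 2 ^+ k.+1)%R%:R.
  by rewrite !mulr_ge0 ?powR_ge0.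
have re : (r + `|t|) `^ (- e) <= r `^ (- e) by rewrite powRN_le// lerDl.
(* The point [0] lies in no shell; there the first power is [0], or [1] when [th = 0], by the
   convention for [powR]. *)
have [t0|tn0] := eqVneq t 0.
  exists 0%N; apply: ler_wpDr => //.
  rewrite expr0 mulr1 expr1 t0 normr0 (ltW r0) mulr1 /riesz_kernel normr0.
  rewrite ler_pM ?powR_ge0//; last by rewrite -{1}(normr0 R) -t0.
  have [->|thn0] := eqVneq th 0; first by rewrite oppr0 !powRr0.
  by rewrite powR0 ?powR_ge0// oppr_eq0.
have tgt0 : 0 < `|t| by rewrite normr_gt0.
have [tr|rt] := leP `|t| r.
  have ex : exists k, r * 2^-1 ^+ k.+1 < `|t|.
    have /cvgrPdist_lt /(_ _ (divr_gt0 tgt0 r0)) : (2^-1 : R) ^+ n @[n --> \oo] --> (0:R).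
      by apply: cvg_expr; rewrite ger0_norm ?invr_ge0// invf_lt1// ltr1n.
    move=> -[k _ /(_ k.+1 (leqnSn k))] /=.
    rewrite sub0r normrN ger0_norm ?exprn_ge0 ?invr_ge0// ltr_pdivlMr// mulrC => h.
    by exists k.
  have [k hk kmin] := ex_minnP ex.
  have tk : `|t| <= r * 2^-1 ^+ k.
    case: k hk kmin => [|k] hk kmin; first by rewrite expr0 mulr1.
    rewrite leNgt; apply/negP => /kmin; by rewrite ltnn.
  exists k; apply: ler_wpDr => //; rewrite tk mulr1.
  by rewrite ler_pM ?powR_ge0// powRN_le// ltW.
have ex : exists k, `|t| <= r * 2 ^+ k.+1.
  have [k hk] : exists k : nat, `|t| / r <= k%:R.
    by exists (Num.trunc (`|t| / r)).+1; rewrite ltW// truncnS_gt.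
  exists k; move: hk; rewrite ler_pdivrMr// mulrC => /le_trans; apply.
  rewrite ler_wpM2l ?(ltW r0)// -natrX ler_nat.
  by rewrite (leq_trans (leqnSn k))// ltnW// ltn_expl.
have [k hk kmin] := ex_minnP ex.
have tk : r * 2 ^+ k <= `|t|.
  case: k hk kmin => [|k] hk kmin; first by rewrite expr0 mulr1 ltW.
  rewrite leNgt; apply/negP => /ltW /kmin; by rewrite ltnn.
exists k; apply: ler_wpDl => //; rewrite hk mulr1 powRD_gt0//.
rewrite ler_pM ?powR_ge0 ?powRN_le//.
by rewrite (le_trans tk)// lerDr ltW.
Qed.

(** The dyadic bound sums to two geometric series, with ratios [q1 < 1] since [th < 1] and [q2 < 1]
    since [1 < th + e]. An interval of half-length [h] contributes [2 * h] whatever its centre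
    [tau], and the power of [r] factors out. *)
Lemma integral_riesz_kernel_le th e : 0 <= th < 1 -> 0 <= e -> 1 < th + e ->
  exists2 C : R, 0 <= C & forall r tau, 0 < r ->
    (\int[leb]_t (riesz_kernel th e r (t - tau))%:E
     <= (C * r `^ (1 - th - e))%:E)%E.
Proof.
move=> /andP[th0 th1] e0 the1.
have h0 : 0 < 2^-1 :> R by rewrite invr_gt0.
pose q1 : R := 2^-1 `^ (1 - th); pose q2 : R := 2 `^ (1 - th - e).
have q1P : 0 <= q1 < 1.
  rewrite powR_ge0/= /q1 /powR gt_eqF// expR_lt1 pmulr_rlt0 ?subr_gt0//.
  by rewrite ln_lt0// h0 invf_lt1// ltr1n.
have q2P : 0 <= q2 < 1.
  rewrite powR_ge0/= /q2 /powR gt_eqF// expR_lt1 pmulr_llt0 ?ln_gt0 ?ltr1n//; lra.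
have g1 : 0 <= (1 - q1)^-1 by rewrite invr_ge0 subr_ge0; case/andP: q1P => _ /ltW.
have g2 : 0 <= (1 - q2)^-1 by rewrite invr_ge0 subr_ge0; case/andP: q2P => _ /ltW.
(* The width [2 * (r * 2^-1 ^+ k)] against the height taken at [k.+1] gives [c1]; the width
   [2 * (r * 2 ^+ k.+1)] gives the factor [4] below. *)
pose c1 : R := 2 * 2^-1 `^ (- th).
have c10 : 0 <= c1 by rewrite mulr_ge0 ?powR_ge0.
exists (c1 * (1 - q1)^-1 + 4 * (1 - q2)^-1); first by rewrite addr_ge0 ?mulr_ge0.
move=> r tau r0.
pose a k : R := (r * 2^-1 ^+ k.+1) `^ (- th) * r `^ (- e).
pose b k : R := (r * 2 ^+ k) `^ (- th - e).
pose f k t : R := a k * \1_(`[tau - r * 2^-1 ^+ k, tau + r * 2^-1 ^+ k]) t.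
pose g k t : R := b k * \1_(`[tau - r * 2 ^+ k.+1, tau + r * 2 ^+ k.+1]) t.
have a0 k : 0 <= a k by rewrite mulr_ge0 ?powR_ge0.
have b0 k : 0 <= b k by rewrite powR_ge0.
have f0 k t : 0 <= f k t by rewrite mulr_ge0.
have g0 k t : 0 <= g k t by rewrite mulr_ge0.
have mf k : measurable_fun setT (f k).
  by apply: measurable_funM => //; exact: measurable_indic.
have mg k : measurable_fun setT (g k).
  by apply: measurable_funM => //; exact: measurable_indic.
apply: (@le_trans _ _ (\int[leb]_t (\sum_(0 <= k <oo) (f k t + g k t)%:E))%E).
  apply: ge0_le_integral_all => t _; first by rewrite lee_fin riesz_kernel_ge0.
  have [k hk] := riesz_kernel_dyadic (t - tau) th0 e0 r0.
  apply: (@le_trans _ _ (\sum_(0 <= i < k.+1) (f i t + g i t)%:E)%E).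
    rewrite big_nat_recr//=; apply: lee_paddl.
      by apply: sume_ge0 => i _; rewrite lee_fin addr_ge0.
    have indE (h : R) : \1_(`[tau - h, tau + h]) t = \1_(`[- h, h]) (t - tau) :> R.
      rewrite !indicE; congr (nat_of_bool _)%:R.
      by apply/idP/idP; rewrite !inE/= !in_itv/= => /andP[? ?]; apply/andP; split; lra.
    by rewrite lee_fin /f /g !indE.
  by apply: nneseries_lim_ge => i _ _; rewrite lee_fin addr_ge0.
rewrite integral_nneseries//; last 2 first.
- by move=> k; apply/measurable_EFinP; exact: (measurable_funD (mf k) (mg k)).
- by move=> k t _; rewrite lee_fin addr_ge0.
have fgE k : (\int[leb]_t (f k t + g k t)%:E =
    (r `^ (1 - th - e) * (c1 * q1 ^+ k + 4 * q2 ^+ k))%:E)%E.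
  under eq_integral do rewrite EFinD.
  rewrite ge0_integralD//; last 4 first.
  - by move=> t _; rewrite lee_fin.
  - by apply/measurable_EFinP; exact: mf.
  - by move=> t _; rewrite lee_fin.
  - by apply/measurable_EFinP; exact: mg.
  rewrite /f /g !integral_interval_cst//; last 2 first.
  - by rewrite mulr_ge0 ?exprn_ge0 ?invr_ge0// ltW.
  - by rewrite mulr_ge0 ?exprn_ge0 ?invr_ge0// ltW.
  rewrite -EFinD; congr EFin; rewrite /a /b /c1 /q1 /q2.
  rewrite !powRM ?exprn_ge0 ?(ltW r0) ?(ltW h0)// !powR_exprn ?(ltW h0)//.
  have -> : 1 - th - e = 1 + (- th + - e) by ring.
  rewrite -!powRS ?powRD_gt0// !exprMn.
  by rewrite !exprS; ring.
rewrite (eq_eseriesr (fun k _ => fgE k)).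
apply: lime_le.
  apply: is_cvg_nneseries => k _ _; rewrite lee_fin mulr_ge0 ?powR_ge0//.
  by rewrite addr_ge0// mulr_ge0// exprn_ge0//; [case/andP: q1P|case/andP: q2P].
apply: nearW => m; rewrite sumEFin lee_fin -mulr_sumr mulrC.
rewrite ler_wpM2r ?powR_ge0// big_mkord big_split/= -!mulr_sumr.
by rewrite lerD// ler_wpM2l// geometric_sum_le.
Qed.

End kernel_integral.

(** * Lower bounds for [cosh_hdist] in coordinates *)

Section ball_kernel.
Variables (R : realType) (n : nat).
Local Notation mR := (measurableTypeR R).
Local Notation leb := (@lebesgue_measure R).
Implicit Types (x z : 'rV[R]_n) (t : n.-tuple mR) (r s : R).

Lemma sqnorm_coord_le x j : x ord0 j ^+ 2 <= sqnorm x.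
Proof. by rewrite /sqnorm (bigD1 j)//= lerDl sumr_ge0// => i _; exact: sqr_ge0. Qed.

(** Cauchy-Schwarz for [dot (x - z) (x + z)], where [sqnorm (x + z) <= 4] by the parallelogram
    identity. *)
Lemma rho_sub_sqr_le x z : hball x -> hball z ->
  (sqnorm x - sqnorm z) ^+ 2 <= 4 * sqnorm (x - z).
Proof.
move=> /rho_gt0 hx /rho_gt0 hz.
have -> : sqnorm x - sqnorm z = dot (x - z) (x + z).
  by rewrite !dotE -!sqnorm_dot (dotC z x); ring.
apply: (le_trans (dot_sqr_le _ _)); rewrite mulrC ler_wpM2r ?sqnorm_ge0//.
have := sqnorm_ge0 (x - z); rewrite !sqnorm_dot !dotE -!sqnorm_dot (dotC z x).
lra.
Qed.

(** [P] is [cosh_hdist x z * (rho * r)]. The identity [(r + rho) ^+ 2 = (r - rho) ^+ 2 + 4 * rho *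
    r] and [rho_sub_sqr_le] give the first bound, which also controls [r]; a coordinate difference
    is at most the norm of [x - z], whence the second. *)
Lemma cosh_hdist_lower_bounds x z j : hball x -> hball z ->
  let r := 1 - sqnorm z in let rho := 1 - sqnorm x in
  let P := rho * r + 2 * sqnorm (x - z) in
  (r + rho) ^+ 2 <= 16 * P /\ (r + `|x ord0 j - z ord0 j|) ^+ 2 <= 16 * P.
Proof.
move=> hx hz r rho P.
have r0 : 0 < r := rho_gt0 hz; have rho0 : 0 < rho := rho_gt0 hx.
have := rho_sub_sqr_le hx hz.
have -> : sqnorm x - sqnorm z = r - rho by rewrite /r /rho; ring.
have := sqnorm_coord_le (x - z) j; rewrite !mxE.
rewrite -(real_normK (num_real (x ord0 j - z ord0 j))).
set y := `|_|; rewrite /P; set S := sqnorm (x - z) => h1 h2.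
have y0 : 0 <= y by exact: normr_ge0.
have rr : 0 <= rho * r by rewrite mulr_ge0// ltW.
split; first by nra.
have : 0 <= (r - y) ^+ 2 by exact: sqr_ge0.
have : r ^+ 2 <= (r + rho) ^+ 2 by nra.
nra.
Qed.

Lemma powRN_half_le (m Q a : R) : 0 < m -> m ^+ 2 <= Q -> 0 <= a ->
  Q `^ (- (a / 2)) <= m `^ (- a).
Proof.
move=> m0 mQ a0; apply: (@le_trans _ _ ((m ^+ 2) `^ (- (a / 2)))).
  by rewrite powRN_le ?exprn_gt0// divr_ge0.
rewrite -powR_mulrn ?(ltW m0)// -powRrM.
by rewrite (_ : 2%:R * - (a / 2) = - a)//; field.
Qed.

(** For the coordinate of largest square, [sqnorm x <= n%:R * x ord0 i ^+ 2], so the others carry at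
    most the fraction [1 - 1/n] of [sqnorm x]. *)
Lemma max_coord_slice x : (0 < n)%N -> hball x ->
  exists i : 'I_n, n%:R^-1 <= 1 - \sum_(j < n | j != i) x ord0 j ^+ 2.
Proof.
move=> n0 hx; pose i0 : 'I_n := Ordinal n0.
case: (@Order.TotalTheory.arg_maxP _ _ _ i0 predT (fun j => x ord0 j ^+ 2)) => // i _ imax.
exists i; have nR0 : 0 < n%:R :> R by rewrite ltr0n.
have sle : sqnorm x <= n%:R * x ord0 i ^+ 2.
  rewrite /sqnorm -[n in n%:R]card_ord mulr_natl -sumr_const.
  by apply: ler_sum => j _; exact: imax.
have : sqnorm x = x ord0 i ^+ 2 + \sum_(j < n | j != i) x ord0 j ^+ 2.
  by rewrite /sqnorm (bigD1 i).
move: hx; rewrite /hball/= => hx eq.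
have n1 : 1 <= n%:R :> R by rewrite ler1n.
rewrite -(ler_pM2l nR0) divff ?gt_eqF//.
set S := \sum_(_ < _ | _) _ in eq *; nra.
Qed.

End ball_kernel.

(** * Domination of the integrand by products of kernels *)

Section kernel_domination.
Variables (R : realType) (n : nat).
Local Notation mR := (measurableTypeR R).
Local Notation leb := (@lebesgue_measure R).
Implicit Types (x z : 'rV[R]_n) (t : n.-tuple mR).

(** Half-length of the chord of the ball through [t] in direction [i]; the square root is [0] when
    the line misses the ball. *)
Definition slice_radius (i : 'I_n) t : R :=
  Num.sqrt (1 - \sum_(j < n | j != i) tnth t j ^+ 2).

(* The height [1 - |x|^2] is at least [(slice_radius - |x_i|) / n] when the
   slice through [x] in direction [i] has half-length at least [1/n]; the
   exponents split [cosh d ^ (- s)] so that the [n - 1] factors in the other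
   directions and the factor in direction [i] are all integrable. *)
Definition slice_kernel (s r : R) (i : 'I_n) t : R :=
  riesz_kernel (n%:R - s) (3 * s / 2 - (n%:R - 1)) r (tnth t i - slice_radius i t) +
  riesz_kernel (n%:R - s) (3 * s / 2 - (n%:R - 1)) r (tnth t i + slice_radius i t).

(** With [th = 0] there is no singularity, and for [0 < s] and [1 < n] the exponent exceeds [1], as
    integrability requires. *)
Definition side_kernel (s r : R) z (j : 'I_n) (y : R) : R :=
  riesz_kernel 0 (1 + s / (2 * (n%:R - 1))) r (y - z ord0 j).

Lemma ball_kernel_le (s : R) z t : (2 <= n)%N -> n%:R - 1 < s < n%:R ->
  hball z -> hball (point_of t) ->
  let r := 1 - sqnorm z in
  exists i, cosh_hdist (point_of t) z `^ (- s) * conf (point_of t) ^+ n <=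
    2 ^+ n * 16 `^ s * n%:R `^ (1 + s / 2) * r `^ s *
    (slice_kernel s r i t * \prod_(j < n | j != i) side_kernel s r z j (tnth t j)).
Proof.
move=> n2 /andP[s1 s2] hz hx r.
set x := point_of t in hx *.
have n0 : (0 < n)%N by exact: ltnW.
have nR : 2 <= n%:R :> R by rewrite ler_nat.
have [i wi] := max_coord_slice n0 hx.
have xE j : x ord0 j = tnth t j by rewrite mxE.
exists i.
pose rho := 1 - sqnorm x; pose P := rho * r + 2 * sqnorm (x - z).
have r0 : 0 < r := rho_gt0 hz; have rho0 : 0 < rho := rho_gt0 hx.
have P0 : 0 < P by rewrite ltr_wpDr ?mulr_gt0// mulr_ge0 ?sqnorm_ge0.
pose e1 := 3 * s / 2 - (n%:R - 1); pose q := 1 + s / (2 * (n%:R - 1)).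
have e10 : 0 <= e1 by rewrite /e1; lra.
have n1 : 0 < n%:R - 1 :> R by lra.
have q0 : 0 <= q by rewrite addr_ge0// divr_ge0//; lra.
have coshE : cosh_hdist x z = P * (rho * r)^-1.
  rewrite /cosh_hdist /P -/rho -/r; field.
  by rewrite !gt_eqF.
have lhsE : cosh_hdist x z `^ (- s) * conf x ^+ n =
    2 ^+ n * r `^ s * rho `^ (- (n%:R - s)) * P `^ (- s).
  rewrite coshE powRM ?invr_ge0 ?mulr_ge0 ?(ltW r0) ?(ltW rho0) ?(ltW P0)//.
  rewrite -(powR_inv1 (mulr_ge0 (ltW rho0) (ltW r0))) -powRrM mulN1r opprK.
  rewrite powRM ?(ltW r0) ?(ltW rho0)// /conf -/rho expr_div_n.
  have -> : - (n%:R - s) = s + - n%:R by ring.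
  by rewrite powRD_gt0// (powRN _ n%:R) powR_mulrn ?(ltW rho0)//; ring.
have [Pr Pj] : (r + rho) ^+ 2 <= 16 * P /\
    forall j, (r + `|x ord0 j - z ord0 j|) ^+ 2 <= 16 * P.
  split; first by case: (cosh_hdist_lower_bounds i hx hz).
  by move=> j; case: (cosh_hdist_lower_bounds j hx hz).
have Q0 : 0 < 16 * P by rewrite mulr_gt0.
have PE : P `^ (- s) = 16 `^ s * (16 * P) `^ (- s).
  rewrite powRM ?(ltW P0)// mulrA -powRD_gt0// subrr powRr0 mul1r//.
(* The exponent [2 * s] of the square root of [16 * P] is shared out: [e1] for the bound by
   [r + rho], and [q] for each of the [n - 1] remaining coordinates. *)
have QE : (16 * P) `^ (- s) = (16 * P) `^ (- (e1 / 2)) *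
    \prod_(j < n | j != i) (16 * P) `^ (- (q / 2)).
  rewrite prodr_const cardC1 card_ord -powR_mulrn ?powR_ge0// -powRrM.
  rewrite -powRD_gt0//; congr (_ `^ _).
  rewrite -subn1 natrB// /e1 /q; field; rewrite gt_eqF//.
have Ple : P `^ (- s) <= 16 `^ s * ((r + rho) `^ (- e1) *
    \prod_(j < n | j != i) side_kernel s r z j (tnth t j)).
  rewrite PE ler_wpM2l ?powR_ge0// QE ler_pM ?powR_ge0 ?prodr_ge0//.
  - by move=> j _; rewrite powR_ge0.
  - by rewrite powRN_half_le// addr_gt0.
  apply: ler_prod => j _; rewrite powR_ge0/= /side_kernel /riesz_kernel.
  rewrite oppr0 powRr0 mul1r -/q -xE powRN_half_le//.
  by rewrite (lt_le_trans r0)// lerDl.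
rewrite lhsE; pose w := 1 - \sum_(j < n | j != i) x ord0 j ^+ 2.
have rhoE : rho = w - tnth t i ^+ 2.
  by rewrite /rho /w /sqnorm (bigD1 i)//= xE; ring.
have radE : slice_radius i t = Num.sqrt w.
  by rewrite /slice_radius /w; congr (Num.sqrt (1 - _)); apply: eq_bigr => j _; rewrite xE.
have w1 : w <= 1 by rewrite gerBl sumr_ge0// => j _; exact: sqr_ge0.
have winv : n%:R^-1 <= w by [].
have ninv0 : 0 < n%:R^-1 :> R by rewrite invr_gt0; lra.
have w0 : 0 < w := lt_le_trans ninv0 winv.
have sw2 : Num.sqrt w ^+ 2 = w by rewrite sqr_sqrtr// ltW.
have sw0 : 0 < Num.sqrt w by rewrite sqrtr_gt0.
have sw1 : Num.sqrt w <= 1 by rewrite -sqrtr1 ler_wsqrtr.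
have swn : n%:R^-1 <= Num.sqrt w by nra.
(* [tau] is the distance from [tnth t i] to the nearer end of the chord; the other factor of [rho]
   is at least [n%:R^-1]. *)
pose tau := Num.sqrt w - `|tnth t i|.
have a0 : 0 <= `|tnth t i| by exact: normr_ge0.
have rhoE' : rho = tau * (Num.sqrt w + `|tnth t i|).
  by rewrite -subr_sqr sw2 real_normK ?num_real.
have tau0 : 0 < tau.
  by rewrite -(pmulr_lgt0 _ (ltr_wpDr a0 sw0)) -rhoE'.
have rhotau : n%:R^-1 * tau <= rho.
  rewrite rhoE' mulrC ler_wpM2l ?(ltW tau0)// (le_trans swn)//.
  by rewrite lerDl.
have ninv1 : n%:R^-1 <= 1 :> R by rewrite invf_le1//; lra.
have nt0 : 0 < n%:R^-1 * tau by rewrite mulr_gt0.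
have th0 : 0 <= n%:R - s by rewrite subr_ge0 ltW.
have powNn a : (n%:R^-1 : R) `^ (- a) = n%:R `^ a.
  by rewrite -powR_inv1 ?ler0n// -powRrM mulN1r opprK.
have rhole : rho `^ (- (n%:R - s)) * (r + rho) `^ (- e1) <=
    n%:R `^ (1 + s / 2) * riesz_kernel (n%:R - s) e1 r tau.
  rewrite /riesz_kernel (gtr0_norm tau0).
  (* Replacing [rho] and [r + rho] by [n%:R^-1] times [tau] and [r + tau] costs [n%:R] to the sum of
     the two exponents. *)
  have -> : 1 + s / 2 = (n%:R - s) + e1 by rewrite /e1; field.
  rewrite powRD_gt0; last by lra.
  have rt0 : 0 <= r + tau by rewrite addr_ge0// ltW.
  rewrite mulrACA -!powNn -!powRM ?rt0 ?(ltW tau0) ?(ltW ninv0)//.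
  rewrite ler_pM ?powR_ge0//; first by rewrite powRN_le.
  rewrite powRN_le//; first by rewrite mulr_gt0// addr_gt0.
  by rewrite mulrDr lerD// ler_piMl// ltW.
(* The sign of [tnth t i] decides which end is nearer, hence which summand of [slice_kernel] is
   used. *)
have taule : riesz_kernel (n%:R - s) e1 r tau <= slice_kernel s r i t.
  rewrite /slice_kernel radE /tau; have [ti0|ti0] := leP 0 (tnth t i).
    rewrite ler_wpDr ?riesz_kernel_ge0// (ger0_norm ti0) /riesz_kernel -/e1.
    by rewrite (distrC (Num.sqrt w)).
  by rewrite ler_wpDl ?riesz_kernel_ge0// (ltr0_norm ti0) opprK (addrC (Num.sqrt w)).
have pr0 : 0 <= \prod_(j < n | j != i) side_kernel s r z j (tnth t j).
  by rewrite prodr_ge0// => j _; exact: riesz_kernel_ge0.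
apply: (@le_trans _ _ (2 ^+ n * r `^ s * rho `^ (- (n%:R - s)) * (16 `^ s * ((r + rho) `^ (- e1) *
    \prod_(j < n | j != i) side_kernel s r z j (tnth t j))))).
  by rewrite ler_wpM2l// !mulr_ge0 ?powR_ge0// exprn_ge0.
have -> : 2 ^+ n * r `^ s * rho `^ (- (n%:R - s)) * (16 `^ s * ((r + rho) `^ (- e1) *
    \prod_(j < n | j != i) side_kernel s r z j (tnth t j))) =
  2 ^+ n * 16 `^ s * r `^ s * ((rho `^ (- (n%:R - s)) * (r + rho) `^ (- e1)) *
    \prod_(j < n | j != i) side_kernel s r z j (tnth t j)) by ring.
have -> : 2 ^+ n * 16 `^ s * n%:R `^ (1 + s / 2) * r `^ s * (slice_kernel s r i t *
  \prod_(j < n | j != i) side_kernel s r z j (tnth t j)) =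
  2 ^+ n * 16 `^ s * r `^ s * ((n%:R `^ (1 + s / 2) * slice_kernel s r i t) *
    \prod_(j < n | j != i) side_kernel s r z j (tnth t j)) by ring.
rewrite ler_wpM2l ?mulr_ge0 ?powR_ge0 ?exprn_ge0// ler_wpM2r//.
by rewrite (le_trans rhole)// ler_wpM2l ?powR_ge0.
Qed.

End kernel_domination.

(** * The uniform integral bound, and small boxes around a point *)

Section kernel_integral_bound.
Variables (R : realType) (n : nat).
Local Notation mR := (measurableTypeR R).
Local Notation leb := (@lebesgue_measure R).
Implicit Types (x z : 'rV[R]_n) (t : n.-tuple mR).

Lemma measurable_slice_radius (i : 'I_n) :
  measurable_fun setT (fun t : n.-tuple mR => slice_radius i t : R).
Proof.
have ms : measurable_fun setT (@Num.sqrt R).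
  by apply: continuous_measurable_fun; exact: sqrt_continuous.
apply: (measurableT_comp ms).
apply: measurable_funB => //; under eq_fun do rewrite big_mkcond.
apply: measurable_sum => j; case: (j != i) => //.
by apply: measurable_funX; exact: measurable_tnth.
Qed.

Lemma measurable_slice_kernel (s r : R) (i : 'I_n) :
  measurable_fun setT (fun t : n.-tuple mR => slice_kernel s r i t).
Proof.
have mr := measurable_slice_radius i.
have mt : measurable_fun setT (fun t : n.-tuple mR => tnth t i : R) := measurable_tnth i.
apply: measurable_funD; apply: measurableT_comp (measurable_riesz_kernel _ _ _) _.
- exact: measurable_funB mt mr.
- exact: measurable_funD mt mr.
Qed.

Lemma measurable_side_kernel (s r : R) z j : measurable_fun setT (side_kernel s r z j).
Proof.
apply: measurableT_comp (measurable_riesz_kernel _ _ _) _.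
exact: measurable_funB.
Qed.

Lemma slice_kernel_ge0 (s r : R) i t : 0 <= slice_kernel s r i t.
Proof. by rewrite addr_ge0// riesz_kernel_ge0. Qed.

Lemma tnth_tset t i (y : mR) : tnth (tset t i y) i = y.
Proof. by rewrite tnth_mktuple eqxx. Qed.

Lemma slice_radius_tset t i (y : mR) : slice_radius i (tset t i y) = slice_radius i t.
Proof.
rewrite /slice_radius; congr (Num.sqrt (1 - _)); apply: eq_bigr => j ji.
by rewrite tnth_mktuple (negbTE ji).
Qed.

Lemma hball_kernel_integral (s : R) : (2 <= n)%N -> n%:R - 1 < s < n%:R ->
  exists2 C : R, 0 <= C & forall z, hball z ->
    exists g : n.-tuple mR -> R, [/\ measurable_fun setT g, forall t, 0 <= g t,
      forall t, hball (point_of t) ->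
        cosh_hdist (point_of t) z `^ (- s) * conf (point_of t) ^+ n <= g t
      & (\int[tuple_lebesgue R n]_t (g t)%:E <= C%:E)%E].
Proof.
move=> n2 s12; have /andP[s1 s2] := s12.
have nR : 2 <= n%:R :> R by rewrite ler_nat.
have n1 : 0 < n%:R - 1 :> R by lra.
have sq0 : 0 < s / (2 * (n%:R - 1)) by rewrite divr_gt0 ?mulr_gt0//; lra.
have [||| C1 C10 hC1] := @integral_riesz_kernel_le R (n%:R - s) (3 * s / 2 - (n%:R - 1)).
- by apply/andP; split; lra.
- by lra.
- by lra.
have [||| C2 C20 hC2] := @integral_riesz_kernel_le R 0 (1 + s / (2 * (n%:R - 1))).
- by rewrite lexx ltr01.
- by lra.
- by lra.
pose C0 : R := 2 ^+ n * 16 `^ s * n%:R `^ (1 + s / 2).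
have C00 : 0 <= C0 by rewrite !mulr_ge0 ?powR_ge0// exprn_ge0.
exists (n%:R * (C0 * (2 * C1 * C2 ^+ n.-1))).
  by rewrite !mulr_ge0// exprn_ge0.
move=> z hz; pose r := 1 - sqnorm z; have r0 : 0 < r := rho_gt0 hz.
pose h i t : R := slice_kernel s r i t * \prod_(j < n | j != i) side_kernel s r z j (tnth t j).
have h0 i t : 0 <= h i t.
  rewrite mulr_ge0 ?slice_kernel_ge0// prodr_ge0// => j _.
  exact: riesz_kernel_ge0.
have mh i : measurable_fun setT (h i).
  apply: measurable_funM; first exact: measurable_slice_kernel.
  by apply: measurable_prod_tnth => j; exact: measurable_side_kernel.
have Cr0 : 0 <= C0 * r `^ s by rewrite mulr_ge0 ?powR_ge0.
(* The direction [i] given by [ball_kernel_le] varies with [t]; the sum over all directions is a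
   measurable majorant. *)
exists (fun t => \sum_(i < n) (C0 * r `^ s) * h i t); split.
- by apply: measurable_sum => i; apply: measurable_funM => //; exact: mh.
- by move=> t; rewrite sumr_ge0// => i _; rewrite mulr_ge0.
- move=> t hx; have [i] := ball_kernel_le n2 s12 hz hx.
  rewrite -/r => /le_trans; apply.
  rewrite [leRHS](bigD1 i)//= ler_wpDr//.
  by rewrite sumr_ge0// => j _; rewrite mulr_ge0.
under eq_integral do rewrite -sumEFin.
rewrite ge0_integral_sum//; last 2 first.
- by move=> i; apply/measurable_EFinP; apply: measurable_funM => //; exact: mh.
- by move=> i t _; rewrite lee_fin mulr_ge0.
have hi i : (\int[tuple_lebesgue R n]_t (C0 * r `^ s * h i t)%:E <=
    (C0 * (2 * C1 * C2 ^+ n.-1))%:E)%E.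
  under eq_integral do rewrite EFinM.
  rewrite ge0_integralZl_EFin//; last 2 first.
  - by move=> t _; rewrite lee_fin.
  - by apply/measurable_EFinP; exact: mh.
  apply: (@le_trans _ _ ((C0 * r `^ s)%:E * ((2 * (C1 * r `^ (1 - (n%:R - s) - (3 * s / 2 - (n%:R - 1))))) *
      (C2 * r `^ (1 - 0 - (1 + s / (2 * (n%:R - 1))))) ^+ n.-1)%:E)%E).
    rewrite lee_wpmul2l// ?lee_fin//.
    apply: integral_slice_le => //.
    - exact: measurable_slice_kernel.
    - exact: slice_kernel_ge0.
    - exact: measurable_side_kernel.
    - by move=> j y; exact: riesz_kernel_ge0.
    - by rewrite !mulr_ge0 ?powR_ge0.
    - by rewrite !mulr_ge0 ?powR_ge0.
    - by move=> j; exact: hC2.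
    move=> t; rewrite /slice_kernel.
    under eq_integral do rewrite slice_radius_tset tnth_tset EFinD.
    have mk a : measurable_fun setT (fun y : mR =>
        (riesz_kernel (n%:R - s) (3 * s / 2 - (n%:R - 1)) r (y + a))%:E).
      apply/measurable_EFinP; apply: measurableT_comp (measurable_riesz_kernel _ _ _) _.
      exact: measurable_funD.
    rewrite ge0_integralD//; try exact: mk;
      try by move=> y _; rewrite lee_fin riesz_kernel_ge0.
    have dbl (a : R) : 2 * a = a + a by ring.
    rewrite dbl EFinD leeD//; first exact: hC1.
    rewrite -[slice_radius i t]opprK; exact: hC1.
  (* The slice factor contributes [r] to the power [- (s / 2)], and so do the side factors together;
     this cancels the power [s], so the constant does not depend on [z]. *)
  rewrite -EFinM lee_fin [(C2 * _) ^+ _]exprMn -[(r `^ _) ^+ _]powR_mulrn ?powR_ge0// -powRrM.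
  have -> : (1 - 0 - (1 + s / (2 * (n%:R - 1)))) * n.-1%:R = - (s / 2).
    by rewrite -subn1 natrB 1?ltnW//; field; rewrite gt_eqF.
  have -> : 1 - (n%:R - s) - (3 * s / 2 - (n%:R - 1)) = - (s / 2) by field.
  have -> : C0 * r `^ s * (2 * (C1 * r `^ (- (s / 2))) * (C2 ^+ n.-1 * r `^ (- (s / 2)))) =
    C0 * (2 * C1 * C2 ^+ n.-1) * (r `^ s * (r `^ (- (s / 2)) * r `^ (- (s / 2)))) by ring.
  by rewrite -!powRD_gt0// (_ : _ + _ = 0) ?powRr0 ?mulr1//; field.
apply: (le_trans (lee_sum _ (fun i _ => hi i))).
by rewrite sumEFin lee_fin sumr_const card_ord -[leLHS]mulr_natl.
Qed.

(** A Euclidean cube of side proportional to [r] is used: the density on it is at least [L], of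
    order [r ^- n], which compensates its volume. The radius [1 / 4] is below [1 / 2], so that boxes
    around points at mutual distance at least [1] are disjoint. *)
Lemma hball_small_box : (0 < n)%N ->
  exists2 v : R, 0 < v & forall z, hball z ->
    exists (E : set (n.-tuple mR)) (L : R), [/\ measurable E, 0 <= L,
      (L%:E * tuple_lebesgue R n E = v%:E)%E &
      forall t, E t -> [/\ hball (point_of t), hdist (point_of t) z <= 1 / 4
        & L <= conf (point_of t) ^+ n]].
Proof.
move=> n0; have nR : 1 <= n%:R :> R by rewrite ler1n.
have e0 : 0 < (40 * n%:R)^-1 :> R by rewrite invr_gt0 mulr_gt0// ltr0n.
(* With this [e] a point of the cube is at Euclidean distance at most [r / 40] from [z], which keeps
   [1 - sqnorm x] between [r / 2] and [2 * r]. *)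
pose e : R := (40 * n%:R)^-1.
exists ((2 * e) ^+ n); first by rewrite exprn_gt0// mulr_gt0.
move=> z hz; pose r := 1 - sqnorm z; have r0 : 0 < r := rho_gt0 hz.
pose h := e * r; have h0 : 0 < h by rewrite mulr_gt0.
pose I j := `[z ord0 j - h, z ord0 j + h]%classic.
pose E : set (n.-tuple mR) := [set t | forall j, I j (tnth t j)].
have indE t : \1_E t = \prod_(j < n) \1_(I j) (tnth t j) :> R.
  rewrite indicE; have [tE|tE] := boolP (t \in E).
    rewrite big1// => j _; rewrite indicE (_ : _ \in _)//.
    by move: tE; rewrite !inE => /(_ j).
  have [j hj] : exists j, ~ I j (tnth t j).
    by apply/existsNP => tI; move/negP: tE; apply; rewrite inE.
  rewrite (bigD1 j)//= indicE (_ : _ \in _ = false) ?mul0r//.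
  by apply/negbTE; rewrite notin_setE.
have mE : measurable E.
  have -> : E = \bigcap_(j in [set: 'I_n]) ((fun t : n.-tuple mR => tnth t j) @^-1` I j).
    by apply/seteqP; split => t /= tE j; [move=> _|]; exact: tE.
  apply: fin_bigcap_measurable => // j _; rewrite -[X in measurable X]setTI.
  apply: (measurable_tnth j) => //; exact: measurable_itv.
exists E, (r ^- n); split => //.
- by rewrite invr_ge0 exprn_ge0// ltW.
- rewrite -[E]setIT -integral_indic//.
  under eq_integral do rewrite indE.
  rewrite (@integral_prod_tnth _ _ (fun j => \1_(I j)) (fun=> 2 * h)).
  + rewrite prodr_const card_ord -EFinM /h; congr EFin.
    have -> : 2 * (e * r) = (2 * e) * r by ring.
    by rewrite exprMn mulrC mulfK// expf_neq0// gt_eqF.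
  + by move=> j; apply: measurable_indic; exact: measurable_itv.
  + by move=> j y; rewrite indicE.
  + move=> j; have := integral_interval_cst (z ord0 j) ler01 (ltW h0).
    by under eq_integral do rewrite mul1r; rewrite mul1r.
move=> t tE; set x := point_of t.
have xz : sqnorm (x - z) <= (r / 40) ^+ 2.
  apply: (@le_trans _ _ (\sum_(j < n) h ^+ 2)).
    apply: ler_sum => j _; rewrite !mxE.
    have : I j (tnth t j) := tE j; rewrite /I/= in_itv/= => /andP[u v].
    rewrite -subr_ge0 subr_sqr mulr_ge0//; lra.
  rewrite sumr_const card_ord -[leLHS]mulr_natl /h /e.
  have -> : n%:R * ((40 * n%:R)^-1 * r) ^+ 2 = n%:R^-1 * (r / 40) ^+ 2 :> R.
    by field; rewrite gt_eqF//; lra.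
  by apply: ler_piMl; [exact: sqr_ge0|rewrite invf_le1//; lra].
pose d := sqnorm (x - z); pose p := dot z (x - z).
have d0 : 0 <= d by exact: sqnorm_ge0.
have xE : sqnorm x = sqnorm z + 2 * p + d.
  by rewrite /p /d !sqnorm_dot !dotE (dotC x z); ring.
have r1 : r <= 1 by rewrite gerBl sqnorm_ge0.
have p2 : p ^+ 2 <= (r / 40) ^+ 2.
  apply: (le_trans (dot_sqr_le _ _)); rewrite -/d.
  have z1 : sqnorm z <= 1 by rewrite ltW.
  exact: le_trans (ler_piMl d0 z1) xz.
have /andP[p_lb p_ub] : - (r / 40) <= p <= r / 40.
  have r40 : 0 <= r / 40 by lra.
  by rewrite -ler_norml -(@ler_pXn2r _ 2) ?nnegrE// real_normK ?num_real.
have dr : d <= r / 40.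
  by apply: (le_trans xz); rewrite expr2; apply: ler_piMl; lra.
have rho_lb : r / 2 <= 1 - sqnorm x by rewrite xE; move: p_lb p_ub dr; rewrite /r; lra.
have rho_ub : 1 - sqnorm x <= 2 * r by rewrite xE; move: p_lb p_ub dr; rewrite /r; lra.
have rho0 : 0 < 1 - sqnorm x by rewrite (lt_le_trans _ rho_lb)// divr_gt0.
have hx : hball x by rewrite /hball/= -subr_gt0.
split => //; last first.
  rewrite -exprVn ler_pXn2r ?nnegrE ?invr_ge0 ?(ltW r0)//.
    by rewrite /conf ler_pdivlMr// ler_pdivrMl// mulrC.
  by rewrite /conf divr_ge0// ltW.
pose T := cosh_hdist x z; have T1 : 1 <= T := cosh_hdist_ge1 hx hz.
(* [1 / 400] is [2 * (r / 40) ^+ 2] divided by [r * (r / 2)]. *)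
have T2 : T - 1 <= 1 / 400.
  rewrite /T /cosh_hdist addrC addKr -/d -/r ler_pdivrMr ?mulr_gt0//.
  have : r * (r / 2) <= r * (1 - sqnorm x) by rewrite ler_wpM2l// ltW.
  move: xz; rewrite -/d expr2; lra.
rewrite /hdist -/(cosh_hdist x z) -/T /arcosh.
have sq : Num.sqrt (T ^+ 2 - 1) <= 1 / 10.
  have T20 : 0 <= T ^+ 2 - 1 by rewrite subr_ge0 exprn_ege1.
  rewrite -(@ler_pXn2r _ 2)// ?nnegrE ?sqrtr_ge0 ?divr_ge0// sqr_sqrtr//.
  have : (T - 1) * (T + 1) <= 1 / 400 * (T + 1) by rewrite ler_wpM2r//; lra.
  rewrite -subr_sqr expr1n; lra.
apply: (@le_trans _ _ (T - 1 + Num.sqrt (T ^+ 2 - 1))); last by lra.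
have -> : T + Num.sqrt (T ^+ 2 - 1) = 1 + (T - 1 + Num.sqrt (T ^+ 2 - 1)) by ring.
by apply: le_ln1Dx; have := sqrtr_ge0 (T ^+ 2 - 1); lra.
Qed.

End kernel_integral_bound.

(** * Comparison of the interaction integral with a sum along the geodesic *)

Section interaction.
Variables (R : realType) (n : nat).
Local Notation mR := (measurableTypeR R).
Implicit Types (x z : 'rV[R]_n) (t : n.-tuple mR) (a b : R).

Lemma sinhR_sub_le (D s : R) : 0 <= s -> sinhR (D - s) <= expR (- s) * sinhR D.
Proof.
move=> s0; rewrite /sinhR mulrA mulrBr -!expRD ler_pM2r ?invr_gt0//.
have -> : - s + D = D - s by ring.
by rewrite lerD2l lerN2 ler_expR; lra.
Qed.

(** A discretized integral along the geodesic: the points at integer distance [k] from [z1] are at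
    distance [D - k] from [z2]. *)
Definition gap_sum a b (D : R) : R :=
  \sum_(k < (Num.trunc D).+1) expR (- (a * k%:R + b * (D - k%:R))).

(* With [h = (d1 + d2 - D) / 2] and [sigma = (d1 - d2 + D) / 2], the point [x]
   projects close to the geodesic point at distance [sigma] from [z1], and [h]
   is comparable with its distance to the geodesic. *)
Lemma near_geodesic_point z1 z2 a b (g : nat -> 'rV[R]_n) x :
  hball z1 -> hball z2 -> hball x -> 0 <= a -> 0 <= b ->
  let D := hdist z1 z2 in 0 < D ->
  (forall k, k%:R <= D -> cosh_hdist x (g k) * sinhR D =
     sinhR (D - k%:R) * cosh_hdist x z1 + sinhR k%:R * cosh_hdist x z2) ->
  (forall k, k%:R <= D -> hball (g k)) ->
  exists2 k, (k <= Num.trunc D)%N &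
    expR (- (a * hdist x z1 + b * hdist x z2)) <=
    expR b * (expR 1 + 1) `^ (a + b) *
      (expR (- (a * k%:R + b * (D - k%:R))) * cosh_hdist x (g k) `^ (- (a + b))).
Proof.
move=> h1 h2 hx a0 b0 D D0 gE gb.
set d1 := hdist x z1; set d2 := hdist x z2.
have d10 : 0 <= d1 := hdist_ge0 hx h1; have d20 : 0 <= d2 := hdist_ge0 hx h2.
have /ler_normlP[dl du] := hdist_triangle_sub hx h1 h2.
have dD : D <= d1 + d2.
  by rewrite /d1 hdistC; exact: hdist_triangle.
pose sg := (d1 - d2 + D) / 2; pose h := (d1 + d2 - D) / 2.
have sg0 : 0 <= sg by rewrite /sg /d1 /d2 /D; lra.
have sgD : sg <= D by rewrite /sg /d1 /d2 /D; lra.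
pose k := Num.trunc sg.
have ks : k%:R <= sg by rewrite truncn_le.
have sk : sg < k%:R + 1 by rewrite natr1; exact: truncnS_gt.
have kD : k%:R <= D := le_trans ks sgD.
exists k; first by rewrite truncn_ge_nat// ltW.
set T := cosh_hdist x (g k).
have T1 : 1 <= T by apply: cosh_hdist_ge1 => //; exact: gb.
have SD : 0 < sinhR D := sinhR_gt0 D0.
(* Since [d1 = h + sg] and [d2 = h + (D - sg)], the two exponential terms are at most [expR (h + 1)]
   and [expR h], because [k <= sg < k + 1]. *)
have Tle : T <= (expR 1 + 1) * expR h.
  rewrite -(ler_pM2r SD) gE//.
  apply: (@le_trans _ _ ((expR (- k%:R) * expR d1 + expR (- (D - k%:R)) * expR d2) * sinhR D)).
    have Dk : 0 <= D - k%:R by rewrite subr_ge0.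
    have C1 : 0 <= cosh_hdist x z1 by rewrite (le_trans ler01)// cosh_hdist_ge1.
    have C2 : 0 <= cosh_hdist x z2 by rewrite (le_trans ler01)// cosh_hdist_ge1.
    rewrite mulrDl; apply: lerD; rewrite [leRHS]mulrAC; apply: ler_pM => //.
    - exact: sinhR_ge0.
    - exact: sinhR_sub_le.
    - by rewrite -coshR_hdist// coshR_le_expR.
    - exact: sinhR_ge0.
    - by rewrite -{1}(subKr D k%:R) sinhR_sub_le.
    - by rewrite -coshR_hdist// coshR_le_expR.
  rewrite ler_pM2r// mulrDl mul1r -!expRD lerD// ler_expR; rewrite /h /sg in sk ks *; lra.
have E0 : 0 < expR 1 + 1 :> R by rewrite addr_gt0 ?expR_gt0.
have eh : expR (- ((a + b) * h)) <= (expR 1 + 1) `^ (a + b) * T `^ (- (a + b)).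
  have -> : expR (- ((a + b) * h)) =
      (expR 1 + 1) `^ (a + b) * ((expR 1 + 1) * expR h) `^ (- (a + b)).
    rewrite powRM ?expR_ge0 ?(ltW E0)// -expRM mulrA -powRD_gt0// subrr powRr0.
    by rewrite mul1r mulrN mulrC.
  rewrite ler_wpM2l ?powR_ge0// powRN_le ?addr_ge0//.
  exact: lt_le_trans T1.
have -> : a * d1 + b * d2 = a * sg + b * (D - sg) + (a + b) * h.
  by rewrite /sg /h; field.
rewrite opprD expRD.
have -> : expR b * (expR 1 + 1) `^ (a + b) *
    (expR (- (a * k%:R + b * (D - k%:R))) * T `^ (- (a + b))) =
  (expR b * expR (- (a * k%:R + b * (D - k%:R)))) *
    ((expR 1 + 1) `^ (a + b) * T `^ (- (a + b))) by ring.
(* Rounding [sg] down to [k] lowers the term in [a] and raises the term in [b] by at most [b], hence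
   the factor [expR b]. *)
rewrite ler_pM ?expR_ge0// -expRD ler_expR.
have : 0 <= a * (sg - k%:R) by rewrite mulr_ge0// subr_ge0.
have : 0 <= b * (k%:R + 1 - sg) by rewrite mulr_ge0// subr_ge0 ltW.
lra.
Qed.

Lemma geodesic_sequence z1 z2 : hball z1 -> hball z2 ->
  let D := hdist z1 z2 in 0 < D ->
  exists g : nat -> 'rV[R]_n, forall k, k%:R <= D ->
    [/\ hball (g k), hdist z1 (g k) = k%:R, hdist z2 (g k) = D - k%:R &
      forall x, hball x -> cosh_hdist x (g k) * sinhR D =
        sinhR (D - k%:R) * cosh_hdist x z1 + sinhR k%:R * cosh_hdist x z2].
Proof.
move=> h1 h2 D D0.
have ex (k : nat) : exists g : 'rV[R]_n, k%:R <= D ->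
    [/\ hball g, hdist z1 g = k%:R, hdist z2 g = D - k%:R &
      forall x, hball x -> cosh_hdist x g * sinhR D =
        sinhR (D - k%:R) * cosh_hdist x z1 + sinhR k%:R * cosh_hdist x z2].
  (* Past [D] no property is required, and [z1] serves as a placeholder. *)
  have [kD|kD] := leP k%:R D; last by exists z1.
  have [|g gP] := @geodesic_point R n z1 z2 k%:R h1 h2 D0; last by exists g.
  by rewrite ler0n kD.
by have [g gP] := choice ex; exists g.
Qed.

(** At each point one [g k] controls the integrand, and the sum of the majorants over all [k] covers
    every choice. The condition [s <= a + b] lets the exponent be weakened to [s], and [a + b <= S]
    bounds the factor from [near_geodesic_point] by [B], so [C] is uniform in [a] and [b]. *)
Lemma interaction_le (s S : R) : (2 <= n)%N -> n%:R - 1 < s < n%:R ->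
  exists2 C : R, 0 <= C & forall a b z1 z2 (X : R) (F : 'rV[R]_n -> R),
    0 <= a -> 0 <= b -> s <= a + b -> a + b <= S ->
    hball z1 -> hball z2 -> 0 < hdist z1 z2 -> 0 <= X ->
    (forall x, hball x ->
       0 <= F x <= X * expR (- (a * hdist x z1 + b * hdist x z2))) ->
    (hintegral F <= (X * C * gap_sum a b (hdist z1 z2))%:E)%E.
Proof.
move=> n2 s12; have [C C0 hC] := hball_kernel_integral n2 s12.
have E1 : 1 <= expR 1 + 1 :> R by rewrite lerDr expR_ge0.
pose B : R := expR S * (expR 1 + 1) `^ S.
have B0 : 0 <= B by rewrite mulr_ge0 ?expR_ge0 ?powR_ge0.
exists (B * C); first by rewrite mulr_ge0.
move=> a b z1 z2 X F a0 b0 sab abS h1 h2; set D := hdist z1 z2 => D0 X0 FX.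
have [g gP] := geodesic_sequence h1 h2 D0.
have kD (k : 'I_(Num.trunc D).+1) : k%:R <= D.
  by rewrite -truncn_ge_nat ?(ltW D0)// -ltnS.
have /choice[G GP] : forall k : 'I_(Num.trunc D).+1, exists G : n.-tuple mR -> R,
    [/\ measurable_fun setT G, forall t, 0 <= G t,
      forall t, hball (point_of t) ->
        cosh_hdist (point_of t) (g k) `^ (- s) * conf (point_of t) ^+ n <= G t
      & (\int[tuple_lebesgue R n]_t (G t)%:E <= C%:E)%E].
  by move=> k; apply: hC; have [] := gP k (kD k).
pose w (k : 'I_(Num.trunc D).+1) : R := expR (- (a * k%:R + b * (D - k%:R))).
have w0 k : 0 <= w k by exact: expR_ge0.
apply: (@le_trans _ _ (\int[tuple_lebesgue R n]_t
    (\sum_(k < (Num.trunc D).+1) (X * B * w k * G k t)%:E))%E).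
  rewrite /hintegral integral_mkcond; apply: ge0_le_integral_all => t _.
    rewrite patchE; case: ifPn => // /set_mem/= hx; rewrite lee_fin mulr_ge0//.
      by have /andP[] := FX _ hx.
    by rewrite exprn_ge0// divr_ge0// ltW// rho_gt0.
  rewrite sumEFin patchE; case: ifPn => [/set_mem/= hx|_]; rewrite lee_fin; last first.
    by apply: sumr_ge0 => k _; have [_ G0 _ _] := GP k; rewrite !mulr_ge0.
  set x := point_of t in hx *.
  have cx0 : 0 <= conf x ^+ n by rewrite exprn_ge0// divr_ge0// ltW// rho_gt0.
  have [k kK hk] := @near_geodesic_point z1 z2 a b g x h1 h2 hx a0 b0 D0
    (fun k kD => let: And4 _ _ _ h := gP k kD in h x hx)
    (fun k kD => let: And4 h _ _ _ := gP k kD in h).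
  have kK' : (k < (Num.trunc D).+1)%N by rewrite ltnS.
  pose k' := Ordinal kK'.
  rewrite (bigD1 k')//= ler_wpDr//.
    by apply: sumr_ge0 => i _; have [_ G0 _ _] := GP i; rewrite !mulr_ge0.
  have [_ _ Gk _] := GP k'; have /andP[F0 Fle] := FX _ hx.
  set T := cosh_hdist x (g k) in hk *.
  have T1 : 1 <= T.
    by rewrite cosh_hdist_ge1//; have [] := gP k (kD k').
  have Ts : T `^ (- (a + b)) <= T `^ (- s) by rewrite ler_powR// lerN2.
  have Bab : expR b * (expR 1 + 1) `^ (a + b) <= B.
    rewrite ler_pM ?expR_ge0 ?powR_ge0//; last exact: ler_powR.
    by rewrite ler_expR; lra.
  apply: (@le_trans _ _ (X * (B * (w k' * T `^ (- s))) * conf x ^+ n)).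
    rewrite ler_wpM2r// (le_trans Fle)// ler_wpM2l// (le_trans hk)//.
    rewrite ler_pM ?mulr_ge0 ?expR_ge0 ?powR_ge0//.
    by rewrite ler_wpM2l ?expR_ge0.
  have -> : X * (B * (w k' * T `^ (- s))) * conf x ^+ n =
    X * B * w k' * (T `^ (- s) * conf x ^+ n) by ring.
  by rewrite ler_wpM2l ?mulr_ge0//; exact: Gk.
rewrite ge0_integral_sum//; last 2 first.
- move=> k; apply/measurable_EFinP; apply: measurable_funM => //.
  by have [] := GP k.
- by move=> k t _; have [_ G0 _ _] := GP k; rewrite lee_fin !mulr_ge0.
apply: (@le_trans _ _ (\sum_(k < (Num.trunc D).+1) (X * B * w k * C)%:E)%E).
  apply: lee_sum => k _; have [mG G0 _ GC] := GP k.
  under eq_integral do rewrite EFinM.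
  rewrite ge0_integralZl_EFin//; last 3 first.
  - by move=> t _; rewrite lee_fin.
  - by apply/measurable_EFinP; exact: mG.
  - by rewrite !mulr_ge0.
  by rewrite [leRHS]EFinM lee_wpmul2l// lee_fin !mulr_ge0.
rewrite sumEFin lee_fin -mulr_suml -mulr_sumr /gap_sum -/w.
by rewrite [X * (B * C)]mulrA [leRHS]mulrAC.
Qed.

(** On the box around [g k] the distances to [z1] and [z2] exceed [k] and [D - k] by at most
    [1 / 4], which costs the factor [expR (- (S / 4))]; each box has weighted volume at least
    [v]. *)
Lemma interaction_ge (S : R) : (2 <= n)%N ->
  exists2 C : R, 0 < C & forall a b z1 z2 (X : R) (F : 'rV[R]_n -> R),
    0 <= a -> 0 <= b -> a + b <= S ->
    hball z1 -> hball z2 -> 0 < hdist z1 z2 -> 0 <= X ->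
    (forall x, hball x ->
       X * expR (- (a * hdist x z1 + b * hdist x z2)) <= F x) ->
    ((X * C * gap_sum a b (hdist z1 z2))%:E <= hintegral F)%E.
Proof.
move=> n2; have [v v0 hv] := @hball_small_box R n (ltnW n2).
exists (expR (- (S / 4)) * v); first by rewrite mulr_gt0 ?expR_gt0.
move=> a b z1 z2 X F a0 b0 abS h1 h2; set D := hdist z1 z2 => D0 X0 FX.
have [g gP] := geodesic_sequence h1 h2 D0.
have kD (k : 'I_(Num.trunc D).+1) : k%:R <= D.
  by rewrite -truncn_ge_nat ?(ltW D0)// -ltnS.
have /choice[E EP] : forall k : 'I_(Num.trunc D).+1, exists EL : set (n.-tuple mR) * R,
    [/\ measurable EL.1, 0 <= EL.2,
      (EL.2%:E * tuple_lebesgue R n EL.1 = v%:E)%E &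
      forall t, EL.1 t -> [/\ hball (point_of t), hdist (point_of t) (g k) <= 1 / 4
        & EL.2 <= conf (point_of t) ^+ n]].
  move=> k; have [|E [L EL]] := hv (g k); last by exists (E, L).
  by have [] := gP k (kD k).
pose w (k : 'I_(Num.trunc D).+1) : R := expR (- (a * k%:R + b * (D - k%:R))).
have w0 k : 0 <= w k by exact: expR_ge0.
pose e : R := expR (- (S / 4)).
have e0 : 0 <= e by exact: expR_ge0.
have L0 k : 0 <= (E k).2 by have [] := EP k.
apply: (@le_trans _ _ (\int[tuple_lebesgue R n]_t
    (\sum_(k < (Num.trunc D).+1) (X * e * w k * (E k).2 * \1_((E k).1) t)%:E))%E).
  rewrite ge0_integral_sum//; last 2 first.
  - move=> k; apply/measurable_EFinP; apply: measurable_funM => //.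
    by apply: measurable_indic; have [] := EP k.
  - by move=> k t _; rewrite lee_fin !mulr_ge0.
  under eq_bigr => k _.
    have [mE _ EL _] := EP k.
    under eq_integral do rewrite EFinM.
    rewrite ge0_integralZl_EFin//; last 2 first.
    - by apply/measurable_EFinP; exact: measurable_indic.
    - by rewrite !mulr_ge0.
    rewrite integral_indic// setIT EFinM -muleA EL -EFinM.
    over.
  rewrite sumEFin lee_fin -mulr_suml -mulr_sumr /gap_sum -/w.
  by rewrite [X * (_ * v)]mulrA [leLHS]mulrAC.
rewrite /hintegral [leRHS]integral_mkcond; apply: ge0_le_integral_all => t _.
  by apply: sume_ge0 => k _; rewrite lee_fin !mulr_ge0.
rewrite sumEFin.
have [[k Ek]|noE] := pselect (exists k, (E k).1 t); last first.
  rewrite big1 => [|k _]; last first.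
    rewrite indicE (_ : _ \in _ = false) ?mulr0//.
    by apply/negbTE; rewrite notin_setE => Ek; apply: noE; exists k.
  rewrite patchE; case: ifPn => // /set_mem/= hx; rewrite lee_fin mulr_ge0//.
    by rewrite (le_trans _ (FX _ hx))// mulr_ge0 ?expR_ge0.
  by rewrite exprn_ge0// divr_ge0// ltW// rho_gt0.
have close (j : 'I_(Num.trunc D).+1) : (E j).1 t ->
    [/\ `|hdist (point_of t) z1 - j%:R| <= 1 / 4 &
      hdist (point_of t) z2 <= D - j%:R + 1 / 4].
  move=> Ej; have [_ _ _ /(_ _ Ej)[hx xg _]] := EP j.
  have [hg g1 g2 _] := gP j (kD j); split.
    rewrite -g1 (hdistC _ z1) (le_trans _ xg)//.
    exact: hdist_triangle_sub.
  rewrite -g2 addrC (hdistC z2) (le_trans (hdist_triangle hx hg h2))//.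
  by rewrite lerD2r.
have [k1 k2] := close k Ek.
rewrite (bigD1 k)//= big1 ?addr0; last first.
  move=> j jk; rewrite indicE (_ : _ \in _ = false) ?mulr0//.
  apply/negbTE; rewrite notin_setE => Ej; have [j1 _] := close j Ej.
  (* Two boxes containing [t] would have indices at most [1 / 2] apart, hence equal: at most one
     term of the sum is nonzero. *)
  have jkR : `|(j%:R : R) - k%:R| < 1.
    rewrite -(subrK (hdist (point_of t) z1) j%:R) -addrA.
    rewrite (le_lt_trans (ler_normD _ _))// distrC.
    by apply: (le_lt_trans (lerD j1 k1)); lra.
  move/negP: jk; apply; apply/eqP/val_inj => /=.
  move: jkR; rewrite ltr_norml => /andP[kj1 jk1].
  have jk2 : (j < k.+1)%N by rewrite -(ltr_nat R) -(natr1 k); lra.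
  have kj2 : (k < j.+1)%N by rewrite -(ltr_nat R) -(natr1 j); lra.
  by apply/eqP; rewrite eqn_leq -ltnS jk2 -ltnS.
have [_ _ _ /(_ _ Ek)[hx xg Lk]] := EP k.
rewrite patchE mem_set// indicE mem_set// mulr1 lee_fin.
apply: ler_pM => //; first by rewrite !mulr_ge0.
apply: le_trans (FX _ hx); rewrite -mulrA ler_wpM2l// -expRD ler_expR.
have : a * hdist (point_of t) z1 <= a * (k%:R + 1 / 4).
  by rewrite ler_wpM2l//; move: k1; rewrite ler_norml => /andP[_]; lra.
have : b * hdist (point_of t) z2 <= b * (D - k%:R + 1 / 4) by rewrite ler_wpM2l.
lra.
Qed.

End interaction.

(** * Size of the gap sum *)

Section gap_sum_bounds.
Variable R : realType.
Implicit Types a b D : R.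

(** The terms are geometric of ratio [expR (- (a - b))]. For [b < a] the end [k = 0] dominates; for
    [a = b] all terms agree, and their number produces the factor [d(z1, z2)]. *)
Lemma gap_sumE a b D : gap_sum a b D =
  expR (- (b * D)) * \sum_(k < (Num.trunc D).+1) expR (- (a - b)) ^+ k.
Proof.
rewrite /gap_sum mulr_sumr; apply: eq_bigr => k _.
by rewrite -expRM_natl -expRD; congr expR; ring.
Qed.

Lemma gap_sum_ge a b D : expR (- (b * D)) <= gap_sum a b D.
Proof.
rewrite gap_sumE ler_peMr ?expR_ge0// big_ord_recl expr0 lerDl.
by apply: sumr_ge0 => k _; rewrite exprn_ge0 ?expR_ge0.
Qed.

Lemma gap_sum_le a b D : b < a ->
  gap_sum a b D <= (1 - expR (- (a - b)))^-1 * expR (- (b * D)).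
Proof.
move=> ba; rewrite gap_sumE mulrC ler_wpM2r ?expR_ge0//.
by apply: geometric_sum_le; rewrite expR_ge0/= expR_lt1 oppr_lt0 subr_gt0.
Qed.

Lemma gap_sum_diag b D : gap_sum b b D = (Num.trunc D).+1%:R * expR (- (b * D)).
Proof.
rewrite gap_sumE subrr oppr0 expR0 mulrC; congr (_ * _).
under eq_bigr do rewrite expr1n.
by rewrite sumr_const card_ord.
Qed.

End gap_sum_bounds.

(** * Interaction of two bubbles *)

Lemma bubble_interaction (R : realType) (n : nat) (p lambda M : R) :
  (2 <= n)%N -> n%:R - 1 < 2 * decay_exponent n lambda ->
  (exists chi1 chi2 : R, [/\ 0 < chi1, 0 < chi2 &
    forall u : R -> R, bubble_profile n p lambda u ->
    forall x z : 'rV[R]_n, hball x -> hball z ->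
      chi1 * expR (- (decay_exponent n lambda * hdist x z)) <= bubble u z x
        <= chi2 * expR (- (decay_exponent n lambda * hdist x z))]) ->
  exists A B : R, [/\ 0 <= A, 0 < B &
    forall (u : R -> R) (alpha beta : R) (z1 z2 : 'rV[R]_n),
      bubble_profile n p lambda u ->
      0 <= alpha -> 0 <= beta -> 2 <= alpha + beta -> alpha + beta <= M ->
      hball z1 -> hball z2 -> 0 < hdist z1 z2 ->
      let S := gap_sum (decay_exponent n lambda * alpha)
                 (decay_exponent n lambda * beta) (hdist z1 z2) in
      ((B * S)%:E <= hintegral (fun x => (bubble u z1 x `^ alpha
                                 * bubble u z2 x `^ beta)%R) <= (A * S)%:E)%E].
Proof.
move=> n2 c2 [chi1 [chi2 [chi10 chi20 hU]]].
set c := decay_exponent n lambda in c2 hU *.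
have nR : 2 <= n%:R :> R by rewrite ler_nat.
have c0 : 0 < c by lra.
(* The kernel bound needs [n - 1 < s < n], and [interaction_le] needs [s <= c * (alpha + beta)],
   which follows from [s <= 2 * c]; the minimum meets both. *)
pose s : R := Num.min ((n%:R - 1 + 2 * c) / 2) (n%:R - 1 / 2).
have s12 : n%:R - 1 < s < n%:R.
  by rewrite lt_min gt_min; apply/andP; split; [apply/andP; split|apply/orP; right]; lra.
have sc : s <= 2 * c by rewrite ge_min; apply/orP; left; lra.
have [C1 C10 hle] := interaction_le (c * M) n2 s12.
have [C2 C20 hge] := interaction_ge (c * M) n2.
(* Powers [alpha + beta] of the decay constants are replaced by powers [M]; comparing with [1] first
   gives the needed monotonicity in the exponent. *)
pose X2 := Num.max 1 chi2 `^ M; pose X1 := Num.min 1 chi1 `^ M.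
have m10 : 0 < Num.min 1 chi1 by rewrite lt_min ltr01.
have X10 : 0 < X1 by rewrite powR_gt0.
have X20 : 0 <= X2 by rewrite powR_ge0.
exists (X2 * C1), (X1 * C2); split; [by rewrite mulr_ge0|by rewrite mulr_gt0|].
move=> u al be z1 z2 hu al0 be0 ab2 abM h1 h2 D0 /=.
have ca0 : 0 <= c * al by rewrite mulr_ge0// ltW.
have cb0 : 0 <= c * be by rewrite mulr_ge0// ltW.
have cabM : c * al + c * be <= c * M by rewrite -mulrDr ler_wpM2l// ltW.
have cab2 : s <= c * al + c * be.
  by rewrite (le_trans sc)// -mulrDr mulrC ler_wpM2l// ltW.
have powE (chi d1 d2 : R) : 0 < chi ->
    (chi * expR (- (c * d1))) `^ al * (chi * expR (- (c * d2))) `^ be =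
    chi `^ (al + be) * expR (- (c * al * d1 + c * be * d2)).
  move=> chi0; rewrite !powRM ?expR_ge0 ?(ltW chi0)// -!expRM powRD_gt0//.
  by rewrite mulrACA -expRD; congr (_ * expR _); ring.
have bd x : hball x ->
    X1 * expR (- (c * al * hdist x z1 + c * be * hdist x z2)) <=
      bubble u z1 x `^ al * bubble u z2 x `^ be <=
    X2 * expR (- (c * al * hdist x z1 + c * be * hdist x z2)).
  move=> hx; have /andP[l1 r1] := hU u hu x z1 hx h1.
  have /andP[l2 r2] := hU u hu x z2 hx h2.
  have p1 d : 0 <= chi1 * expR (- (c * d)) by rewrite mulr_ge0 ?expR_ge0// ltW.
  have p2 d : 0 <= chi2 * expR (- (c * d)) by rewrite mulr_ge0 ?expR_ge0// ltW.
  have q1 := le_trans (p1 _) l1; have q2 := le_trans (p1 _) l2.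
  apply/andP; split.
    apply: (@le_trans _ _ ((chi1 * expR (- (c * hdist x z1))) `^ al *
        (chi1 * expR (- (c * hdist x z2))) `^ be)).
      rewrite powE// ler_wpM2r ?expR_ge0//.
      apply: (@le_trans _ _ (Num.min 1 chi1 `^ (al + be))).
        by apply: ger_powR => //; rewrite m10 ge_min lexx.
      by apply: ge0_ler_powR; rewrite ?nnegrE ?addr_ge0 ?(ltW m10) ?(ltW chi10)// ge_min lexx orbT.
    by apply: ler_pM; rewrite ?powR_ge0// ge0_ler_powR ?nnegrE.
  apply: (@le_trans _ _ ((chi2 * expR (- (c * hdist x z1))) `^ al *
      (chi2 * expR (- (c * hdist x z2))) `^ be)).
    by apply: ler_pM; rewrite ?powR_ge0// ge0_ler_powR ?nnegrE.
  rewrite powE// ler_wpM2r ?expR_ge0//.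
  apply: (@le_trans _ _ (Num.max 1 chi2 `^ (al + be))).
    by apply: ge0_ler_powR; rewrite ?nnegrE ?addr_ge0 ?le_max ?ler01 ?(ltW chi20) ?lexx ?orbT.
  by apply: ler_powR => //; rewrite le_max lexx.
apply/andP; split.
  by apply: hge => //; [exact: ltW|move=> x /bd /andP[]].
apply: hle => // x hx; have /andP[_ ->] := bd x hx.
by rewrite mulr_ge0 ?powR_ge0.
Qed.

(** The gap [2 c - (n - 1)] is a positive square root, which leaves room for [s] between [n - 1] and
    [2 c]. *)
Lemma decay_exponent_gt (R : realType) (n : nat) (lambda : R) :
  lambda < (n%:R - 1) ^+ 2 / 4 -> n%:R - 1 < 2 * decay_exponent n lambda.
Proof.
move=> hl; rewrite /decay_exponent mulrC divfK ?pnatr_eq0// ltrDl sqrtr_gt0.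
lra.
Qed.

(** The constants may depend on [M], since the pointwise bounds carry [chi1] and [chi2] to the power
    [alpha + beta]. *)
Theorem lemma4p1 (R : realType) (n : nat) (p lambda : R)
  (hn : (3 <= n)%N) (hp : 1 < p)
  (hcond :
    (p < (n%:R + 2) / (n%:R - 2) /\ lambda < (n%:R - 1) ^+ 2 / 4)
    \/ [/\ (4 <= n)%N, p = (n%:R + 2) / (n%:R - 2),
           n%:R * (n%:R - 2) / 4 < lambda
         & lambda < (n%:R - 1) ^+ 2 / 4])
  (hdecay : exists chi1 chi2 : R, [/\ 0 < chi1, 0 < chi2 &
    forall u : R -> R, bubble_profile n p lambda u ->
    forall x z : 'rV[R]_n, hball x -> hball z ->
      chi1 * expR (- (decay_exponent n lambda * hdist x z)) <= bubble u z x
        <= chi2 * expR (- (decay_exponent n lambda * hdist x z))]) :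
  (forall delta M : R, 0 < delta -> exists2 C : R, 1 <= C &
    forall (u : R -> R) (alpha beta : R) (z1 z2 : 'rV[R]_n),
      bubble_profile n p lambda u ->
      0 <= alpha -> 0 <= beta -> 2 <= alpha + beta -> alpha + beta <= M ->
      `|alpha - beta| = delta ->
      hball z1 -> hball z2 -> ln 3 <= hdist z1 z2 ->
      ((C^-1 * expR (- (decay_exponent n lambda * Num.min alpha beta
                        * hdist z1 z2)))%:E
         <= hintegral (fun x => (bubble u z1 x `^ alpha
                                 * bubble u z2 x `^ beta)%R)
         <= (C * expR (- (decay_exponent n lambda * Num.min alpha beta
                          * hdist z1 z2)))%:E)%E)
  /\
  (forall M : R, exists2 C : R, 1 <= C &
    forall (u : R -> R) (alpha beta : R) (z1 z2 : 'rV[R]_n),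
      bubble_profile n p lambda u ->
      0 <= alpha -> 0 <= beta -> 2 <= alpha + beta -> alpha + beta <= M ->
      alpha = beta ->
      hball z1 -> hball z2 -> ln 3 <= hdist z1 z2 ->
      ((C^-1 * hdist z1 z2
          * expR (- (decay_exponent n lambda * beta * hdist z1 z2)))%:E
         <= hintegral (fun x => (bubble u z1 x `^ alpha
                                 * bubble u z2 x `^ beta)%R)
         <= (C * hdist z1 z2
          * expR (- (decay_exponent n lambda * beta * hdist z1 z2)))%:E)%E).
Proof.
have hl : lambda < (n%:R - 1) ^+ 2 / 4 by case: hcond => [[]|[]].
have n2 : (2 <= n)%N := ltnW hn.
have nR : 2 <= n%:R :> R by rewrite ler_nat.
have c2 := decay_exponent_gt hl.
have bi M := bubble_interaction M n2 c2 hdecay.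
set c := decay_exponent n lambda in c2 bi *.
have c0 : 0 < c by lra.
have ln30 : 0 < ln 3 :> R by rewrite ln_gt0// ltr1n.
split.
- move=> delta M delta0; have [A [B [A0 B0 hAB]]] := bi M.
  pose q : R := (1 - expR (- (c * delta)))^-1.
  have cd0 : 0 < c * delta by rewrite mulr_gt0.
  have q0 : 0 < q by rewrite invr_gt0 subr_gt0 expR_lt1 oppr_lt0.
  have Bi : 0 < B^-1 by rewrite invr_gt0.
  have Aq : 0 <= A * q by rewrite mulr_ge0// ltW.
  (* The three summands serve [1 <= C], the upper bound and the lower bound. *)
  exists (1 + A * q + B^-1); first by lra.
  (* The case where [beta] is the minimum; the other one follows by exchanging the two bubbles. *)
  have main (u : R -> R) (al be : R) (z1 z2 : 'rV[R]_n) : bubble_profile n p lambda u ->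
      0 <= al -> 0 <= be -> 2 <= al + be -> al + be <= M -> al - be = delta ->
      hball z1 -> hball z2 -> ln 3 <= hdist z1 z2 ->
      (((1 + A * q + B^-1)^-1 * expR (- (c * be * hdist z1 z2)))%:E
         <= hintegral (fun x => (bubble u z1 x `^ al * bubble u z2 x `^ be)%R)
         <= ((1 + A * q + B^-1) * expR (- (c * be * hdist z1 z2)))%:E)%E.
    move=> hu al0 be0 ab2 abM dl h1 h2 D3.
    have /andP[lo up] := hAB u al be z1 z2 hu al0 be0 ab2 abM h1 h2 (lt_le_trans ln30 D3).
    apply/andP; split.
      apply: le_trans lo; rewrite lee_fin ler_pM ?expR_ge0 ?gap_sum_ge ?invr_ge0//; first by lra.
      by rewrite invf_ple ?posrE//; lra.
    apply: (le_trans up); rewrite lee_fin.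
    apply: (@le_trans _ _ (A * (q * expR (- (c * be * hdist z1 z2))))).
      rewrite ler_wpM2l// /q -dl mulrBr gap_sum_le//.
      by rewrite ltr_pM2l// -subr_gt0 dl.
    by rewrite mulrA ler_wpM2r ?expR_ge0//; lra.
  move=> u al be z1 z2 hu al0 be0 ab2 abM dl h1 h2 D3.
  have [bea|abe] := leP be al.
    by apply: main => //; rewrite -dl ger0_norm// subr_ge0.
  rewrite hdistC; under eq_fun do rewrite mulrC.
  apply: main => //; [by rewrite addrC|by rewrite addrC| |by rewrite hdistC].
  by rewrite -dl ltr0_norm ?subr_lt0// opprB.
- move=> M; have [A [B [A0 B0 hAB]]] := bi M.
  (* The number of terms, [Num.trunc D] plus one, is at most [L * D] because [ln 3 <= D]. *)
  pose L : R := 1 + (ln 3)^-1.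
  have L0 : 0 < L by rewrite addr_gt0// invr_gt0.
  have Bi : 0 < B^-1 by rewrite invr_gt0.
  have AL : 0 <= A * L by rewrite mulr_ge0// ltW.
  exists (1 + A * L + B^-1); first by lra.
  move=> u al be z1 z2 hu al0 be0 ab2 abM alE h1 h2 D3; subst al.
  have D0 := lt_le_trans ln30 D3.
  have /andP[lo up] := hAB u be be z1 z2 hu be0 be0 ab2 abM h1 h2 D0.
  rewrite gap_sum_diag in lo up.
  apply/andP; split.
    apply: le_trans lo; rewrite lee_fin mulrA ler_wpM2r ?expR_ge0//.
    apply: ler_pM; rewrite ?invr_ge0 ?(ltW D0)//; first by lra.
      by rewrite invf_ple ?posrE//; lra.
    exact/ltW/truncnS_gt.
  apply: (le_trans up); rewrite lee_fin mulrA ler_wpM2r ?expR_ge0//.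
  apply: (@le_trans _ _ (A * (L * hdist z1 z2))).
    rewrite ler_wpM2l// /L mulrDl mul1r -natr1 lerD ?truncn_le ?(ltW D0)//.
    by rewrite ler_pdivlMl// mulr1.
  by rewrite mulrA ler_wpM2r ?(ltW D0)//; lra.
Qed.
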